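(* $4$-SUM $\in \mathsf{AM}\left[\log_2 n,\ \widetilde{O}(n)\right]$. That is, there is an Arthur–Merlin protocol for $4$-SUM in which, on input four sequences of $n$ integers each, the proof sent by Merlin has length at most $\log_2 n$ bits and Arthur's deterministic verification runs in time $\widetilde{O}(n)$; on yes-instances, with probability at least $2/3$ over the shared randomness there is a proof that Arthur accepts, and on no-instances Arthur rejects every proof with probability $1$.
   Context: $4$-SUM: given four sequences $A_1,A_2,A_3,A_4$, each of $n$ integers of absolute value at most $n^{O(1)}$, decide whether there exist indices $i_1,i_2,i_3,i_4\in[n]$ with $A_1[i_1]+A_2[i_2]+A_3[i_3]+A_4[i_4]=0$. A language $L\subseteq\{0,1\}^*$ belongs to $\mathsf{AM}[s(n),t(n)]$ if there is an Arthur–Merlin protocol (public coins: a random string is shared between prover and verifier; upon seeing it the prover sends a proof; the verifier is deterministic) such that for every input $x$ of length $n$, the proof length is at most $s(n)$, the verification time is at most $t(n)$, for every $x\in L$ the verifier accepts (for a suitable proof) with probability at least $2/3$ over the shared randomness, and for every $x\notin L$ the verifier rejects every proof with probability $1$. $\widetilde{O}(\cdot)$ hides polylogarithmic factors. *)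

(* Defs.v *)
From mathcomp Require Import all_boot all_order all_algebra.
Set Implicit Arguments. Unset Strict Implicit. Unset Printing Implicit Defensive.
Import Order.TTheory GRing.Theory Num.Theory.
Local Open Scope ring_scope.

Definition four_sum (n : nat) (A1 A2 A3 A4 : seq int) : Prop :=
  exists i1 i2 i3 i4 : nat,
    [/\ (i1 < n)%N, (i2 < n)%N, (i3 < n)%N & (i4 < n)%N] /\
    nth 0 A1 i1 + nth 0 A2 i2 + nth 0 A3 i3 + nth 0 A4 i4 = 0.

(* Word RAM.  Registers indexed by nat, memory indexed by int (initially 0), *)
(* three read-only arrays: the input words, the shared random bits, and     *)
(* Merlin's proof bits.  Every instruction costs one time step.  Words are  *)
(* bounded by W in absolute value (W polynomial in n, i.e. O(log n)-bit     *)
(* words); writing a value of absolute value > W crashes the machine        *)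
(* (which counts as non-acceptance).                                        *)

Inductive instr :=
| IConst  (d : nat) (k : int)
| IAdd    (d a b : nat)
| ISub    (d a b : nat)
| IMul    (d a b : nat)
| IDiv    (d a b : nat)
| IMod    (d a b : nat)
| ILoad   (d a : nat)
| IStore  (a b : nat)
| IInput  (d a : nat)
| IRand   (d a : nat)
| IProof  (d a : nat)
| IJz     (r t : nat)
| IJneg   (r t : nat)
| IAccept
| IReject.

Record config := Config { pc : nat; regs : nat -> int; mem : int -> int }.

Inductive outcome := Running of config | Halted of bool | Crashed.

Definition nth_at (T : Type) (x0 : T) (s : seq T) (a : int) : T :=
  if (0 <= a) then nth x0 s `|a|%N else x0.

Definition step (P : seq instr) (W : nat) (inp : seq int)
    (rnd prf : seq bool) (c : config) : outcome :=
  let R := regs c in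
  let wr d (v : int) :=
      if `|v| <= W%:Z then
        Running (Config (pc c).+1 (fun i => if i == d then v else R i) (mem c))
      else Crashed in
  if (size P <= pc c)%N then Crashed else
  match nth IReject P (pc c) with
  | IConst d k => wr d k
  | IAdd d a b => wr d (R a + R b)
  | ISub d a b => wr d (R a - R b)
  | IMul d a b => wr d (R a * R b)
  | IDiv d a b => wr d (R a %/ R b)%Z
  | IMod d a b => wr d (R a %% R b)%Z
  | ILoad d a => wr d (mem c (R a))
  | IStore a b =>
      Running (Config (pc c).+1 (regs c)
                 (fun x => if x == R a then R b else mem c x))
  | IInput d a => wr d (nth_at 0 inp (R a))
  | IRand d a => wr d (nth_at false rnd (R a) : nat)%:Z
  | IProof d a => wr d (nth_at false prf (R a) : nat)%:Z
  | IJz r t => Running (Config (if R r == 0 then t else (pc c).+1) R (mem c))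
  | IJneg r t => Running (Config (if R r < 0 then t else (pc c).+1) R (mem c))
  | IAccept => Halted true
  | IReject => Halted false
  end.

Fixpoint run (P : seq instr) (W : nat) (inp : seq int) (rnd prf : seq bool)
    (fuel : nat) (c : config) : option bool :=
  match fuel with
  | 0 => None
  | fuel'.+1 =>
      match step P W inp rnd prf c with
      | Running c' => run P W inp rnd prf fuel' c'
      | Halted b => Some b
      | Crashed => None
      end
  end.

Definition init_config (n m l : nat) : config :=
  Config 0 (fun i => if i == 0%N then n%:Z else if i == 1%N then m%:Z
                     else if i == 2%N then l%:Z else 0) (fun _ => 0).

Definition accepts (P : seq instr) (W T n : nat) (inp : seq int)
    (rnd prf : seq bool) : bool :=
  run P W inp rnd prf T (init_config n (size rnd) (size prf)) == Some true.

(* Main.v *)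
Require Import Defs.
From mathcomp Require Import all_boot all_order all_algebra.
From mathcomp Require Import zify ring.
Import Order.TTheory GRing.Theory Num.Theory.
Local Open Scope ring_scope.

(** Fix a random multiplier [a < M = 2^w] with [w = O(log n)] and split [[0, M)]
into [B = 2^L] buckets of width [D = M / B], where [L] is the integer part of
[log_2 n]; [x] lies in bucket [((a * x) mod M) / D].  Buckets are additive up to
a carry, so once Merlin sends the bucket [rr] of [s = A1[i1] + A2[i2]], each [x]
of [A1] can only be completed to [s] by elements of [A2] in the two buckets
[rr - bucket x] and [rr - bucket x - 1] modulo [B]; the same holds for [-A3] and
[-A4].  A pair whose sum differs from [s] passes this test for at most [20 * D]
of the multipliers, hence on average there are [O(n)] such pairs, and by Markov's
inequality Arthur can enumerate all candidates in quasilinear time for at least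
two thirds of the multipliers.  Arthur accepts only on finding a common value of
the two candidate lists, which is a genuine solution.  The address space of the
machine is polynomially large and zero-initialised, so these lists are compared
by direct addressing, and the time bound on accepting runs replaces an explicit
abort. *)

(** * A structured language on top of the word RAM *)

Inductive com :=
| Block of seq instr
| Seq of com & com
| IfNZ of nat & com
| While of nat & com.

Fixpoint csize (c : com) : nat :=
  match c with
  | Block bk => size bk
  | Seq c1 c2 => csize c1 + csize c2
  | IfNZ _ c => (csize c).+1
  | While _ c => csize c + 3
  end.

(* The machine has no unconditional jump: register 3 is zeroed just before
   the backward jump of a loop. *)
Fixpoint compile (p : nat) (c : com) : seq instr :=
  match c with
  | Block bk => bk
  | Seq c1 c2 => compile p c1 ++ compile (p + csize c1) c2
  | IfNZ r c => IJz r (p + (csize c).+1) :: compile p.+1 c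
  | While r c =>
      IJz r (p + (csize c + 3)) :: compile p.+1 c ++ [:: IConst 3 0; IJz 3 p]
  end.

Lemma size_compile c p : size (compile p c) = csize c.
Proof.
elim: c p => [bk|c1 IH1 c2 IH2|r c IH|r c IH] p //=.
- by rewrite size_cat IH1 IH2.
- by rewrite IH.
- by rewrite size_cat IH /=; lia.
Qed.

Definition code_at (P : seq instr) (p : nat) (bk : seq instr) : Prop :=
  exists pre post, P = pre ++ bk ++ post /\ size pre = p.

Lemma code_at_catl P p bk1 bk2 : code_at P p (bk1 ++ bk2) -> code_at P p bk1.
Proof. by move=> [pre [post [-> <-]]]; exists pre, (bk2 ++ post); rewrite -catA. Qed.

Lemma code_at_catr P p bk1 bk2 :
  code_at P p (bk1 ++ bk2) -> code_at P (p + size bk1) bk2.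
Proof.
move=> [pre [post [-> <-]]]; exists (pre ++ bk1), post.
by rewrite size_cat -!catA.
Qed.

Lemma code_at_head P p i bk :
  code_at P p (i :: bk) -> (p < size P)%N /\ nth IReject P p = i.
Proof.
move=> [pre [post [-> <-]]]; split; first by rewrite !size_cat /=; lia.
by rewrite nth_cat ltnn subnn.
Qed.

Lemma code_at_tail P p i bk : code_at P p (i :: bk) -> code_at P p.+1 bk.
Proof. by rewrite -cat1s => /code_at_catr; rewrite addn1. Qed.

Definition upd (R : nat -> int) (d : nat) (v : int) : nat -> int :=
  fun i => if i == d then v else R i.

Lemma updE R d v i : upd R d v i = if i == d then v else R i.
Proof. by []. Qed.

(* [clk] is a ghost counter of the machine steps executed so far. *)
Record state := State { clk : nat; reg : nat -> int; mm : int -> int }.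

Definition cfg (p : nat) (s : state) : config := Config p (reg s) (mm s).

(** * Weakest preconditions with a step counter *)

Section Logic.
Variables (P : seq instr) (W : nat) (inp : seq int) (rnd prf : seq bool).
Variable Post : bool -> nat -> Prop.

Local Notation mstep := (step P W inp rnd prf).
Local Notation mrun := (run P W inp rnd prf).

(** The verdict is required for every fuel from [t] on, so it holds under any larger time budget.
    [Post] sees the absolute clock, [t0] being the steps already spent. *)
Definition halts (c : config) (t0 : nat) : Prop :=
  exists t b, (forall f, mrun (t + f) c = Some b) /\ Post b (t0 + t).

Lemma halts_step c c' t : mstep c = Running c' -> halts c' t.+1 -> halts c t.
Proof.
move=> e [t1 [b [hr hP]]]; exists t1.+1, b; split=> [f|]; last by rewrite addnS.
by rewrite addSn /= e.
Qed.

Lemma halts_done c b t : mstep c = Halted b -> Post b t.+1 -> halts c t.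
Proof.
move=> e hP; exists 1%N, b; split=> [f|]; last by rewrite addn1.
by rewrite addSn /= e.
Qed.

(* Weakest precondition in continuation-passing style; halting inside [c] is
   allowed provided that it establishes [Post]. *)
Definition wp (c : com) (Q : state -> Prop) (s : state) : Prop :=
  forall p, code_at P p (compile p c) ->
  (forall s', Q s' -> halts (cfg (p + csize c) s') (clk s')) ->
  halts (cfg p s) (clk s).

Lemma wp_nil (Q : state -> Prop) s : Q s -> wp (Block [::]) Q s.
Proof. by move=> q p _ k; have := k _ q; rewrite addn0. Qed.

Lemma wp_seq c1 c2 Q s : wp c1 (wp c2 Q) s -> wp (Seq c1 c2) Q s.
Proof.
move=> w p hp k; apply: w; first exact: code_at_catl hp.
move=> s' w2; apply: w2; first by have := code_at_catr _ _ _ _ hp; rewrite size_compile.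
by move=> s'' /k; rewrite /= addnA.
Qed.

Lemma wp_if r c (Q : state -> Prop) t R m :
  (R r = 0 -> Q (State t.+1 R m)) ->
  (R r <> 0 -> wp c Q (State t.+1 R m)) ->
  wp (IfNZ r c) Q (State t R m).
Proof.
move=> h0 h1 p hp k; have [hs hn] := code_at_head _ _ _ _ hp.
apply: halts_step; first by rewrite /step /= leqNgt hs /= hn.
case: eqP => [e|ne]; first by have := k _ (h0 e).
apply: (h1 ne p.+1); first exact: code_at_tail hp.
by move=> s' /k; rewrite /= addSnnS.
Qed.

(** A single unfolding of the loop; termination is left to an induction at each use. The two extra
    ticks and the zeroed register 3 come from the backward jump. *)
Lemma wp_while r c (Q : state -> Prop) t R m :
  (R r = 0 -> Q (State t.+1 R m)) ->
  (R r <> 0 ->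
     wp c (fun s => wp (While r c) Q
                      (State (clk s).+2 (upd (reg s) 3 0) (mm s)))
        (State t.+1 R m)) ->
  wp (While r c) Q (State t R m).
Proof.
move=> h0 h1 p hp k; have [hs hn] := code_at_head _ _ _ _ hp.
apply: halts_step; first by rewrite /step /= leqNgt hs /= hn.
case: eqP => [e|ne]; first by have := k _ (h0 e).
have hp1 := code_at_tail _ _ _ _ hp.
apply: (h1 ne p.+1); first exact: code_at_catl hp1.
move=> s' w; have := code_at_catr _ _ _ _ hp1; rewrite size_compile => hp2.
have [hs2 hn2] := code_at_head _ _ _ _ hp2.
have [hs3 hn3] := code_at_head _ _ _ _ (code_at_tail _ _ _ _ hp2).
apply: halts_step; first by rewrite /step /= leqNgt hs2 /= hn2.
apply: halts_step; first by rewrite /step /= leqNgt hs3 /= hn3.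
exact: (w p hp k).
Qed.

Lemma wp_cons i bk Q s s' :
  (forall p, (size P <= p)%N = false -> nth IReject P p = i ->
     mstep (cfg p s) = Running (cfg p.+1 s')) ->
  clk s' = (clk s).+1 ->
  wp (Block bk) Q s' -> wp (Block (i :: bk)) Q s.
Proof.
move=> hi hc w p hp k; have [hs hn] := code_at_head _ _ _ _ hp.
apply: halts_step; first by apply: hi => //; rewrite leqNgt hs.
rewrite -hc; apply: w; first exact: code_at_tail hp.
by move=> s'' /k; rewrite /= addSnnS.
Qed.

Section Rules.
Variables (bk : seq instr) (Q : state -> Prop) (t : nat) (R : nat -> int).
Variables (m : int -> int) (d a b : nat).

Local Notation after v := (wp (Block bk) Q (State t.+1 (upd R d v) m)).
Local Ltac rule h :=
  apply: wp_cons => // p; rewrite /step /= => -> /= ->; rewrite /= ?h.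

Lemma wp_const k : `|k| <= W%:Z -> after k ->
  wp (Block (IConst d k :: bk)) Q (State t R m).
Proof. by move=> h; rule h. Qed.

Lemma wp_add : `|R a + R b| <= W%:Z -> after (R a + R b) ->
  wp (Block (IAdd d a b :: bk)) Q (State t R m).
Proof. by move=> h; rule h. Qed.

Lemma wp_sub : `|R a - R b| <= W%:Z -> after (R a - R b) ->
  wp (Block (ISub d a b :: bk)) Q (State t R m).
Proof. by move=> h; rule h. Qed.

Lemma wp_mul : `|R a * R b| <= W%:Z -> after (R a * R b) ->
  wp (Block (IMul d a b :: bk)) Q (State t R m).
Proof. by move=> h; rule h. Qed.

Lemma wp_div : `|(R a %/ R b)%Z| <= W%:Z -> after (R a %/ R b)%Z ->
  wp (Block (IDiv d a b :: bk)) Q (State t R m).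
Proof. by move=> h; rule h. Qed.

Lemma wp_mod : `|(R a %% R b)%Z| <= W%:Z -> after (R a %% R b)%Z ->
  wp (Block (IMod d a b :: bk)) Q (State t R m).
Proof. by move=> h; rule h. Qed.

Lemma wp_load : `|m (R a)| <= W%:Z -> after (m (R a)) ->
  wp (Block (ILoad d a :: bk)) Q (State t R m).
Proof. by move=> h; rule h. Qed.

Lemma wp_store :
  wp (Block bk) Q (State t.+1 R (fun x => if x == R a then R b else m x)) ->
  wp (Block (IStore a b :: bk)) Q (State t R m).
Proof. by rule I. Qed.

Lemma wp_input : `|nth_at 0 inp (R a)| <= W%:Z -> after (nth_at 0 inp (R a)) ->
  wp (Block (IInput d a :: bk)) Q (State t R m).
Proof. by move=> h; rule h. Qed.

Lemma wp_rand : (0 < W)%N -> after (nth_at false rnd (R a) : nat)%:Z ->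
  wp (Block (IRand d a :: bk)) Q (State t R m).
Proof.
move=> h; have {}h : `|(nth_at false rnd (R a) : nat)%:Z| <= W%:Z by case: (nth_at _ _ _); rewrite /=; lia.
by rule h.
Qed.

Lemma wp_proof : (0 < W)%N -> after (nth_at false prf (R a) : nat)%:Z ->
  wp (Block (IProof d a :: bk)) Q (State t R m).
Proof.
move=> h; have {}h : `|(nth_at false prf (R a) : nat)%:Z| <= W%:Z by case: (nth_at _ _ _); rewrite /=; lia.
by rule h.
Qed.

End Rules.

Lemma wp_accept bk Q t R m :
  Post true t.+1 -> wp (Block (IAccept :: bk)) Q (State t R m).
Proof.
move=> h p hp _; have [hs hn] := code_at_head _ _ _ _ hp.
by apply: halts_done h; rewrite /step /= leqNgt hs /= hn.
Qed.

Lemma wp_reject bk Q t R m :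
  Post false t.+1 -> wp (Block (IReject :: bk)) Q (State t R m).
Proof.
move=> h p hp _; have [hs hn] := code_at_head _ _ _ _ hp.
by apply: halts_done h; rewrite /step /= leqNgt hs /= hn.
Qed.

End Logic.

(** * The verifier *)

(* Eight tables indexed by [int], interleaved in the memory. *)
Definition tab (m : int -> int) (t : nat) (v : int) : int := m (v * 8 + t%:Z).

(** Registers 15 and 16 are scratch space for the address; register 5 is expected to hold the
    constant 8. *)
Definition tload (d v t : nat) : seq instr :=
  [:: IConst 15 t%:Z; IMul 16 v 5; IAdd 16 16 15; ILoad d 16].

Definition tstore (v t b : nat) : seq instr :=
  [:: IConst 15 t%:Z; IMul 16 v 5; IAdd 16 16 15; IStore 16 b].

Definition tset (m : int -> int) (t : nat) (v z : int) : int -> int :=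
  fun x => if x == v * 8 + t%:Z then z else m x.

Lemma tab_tset m t v z t' v' : (t < 8)%N -> (t' < 8)%N ->
  tab (tset m t v z) t' v' = if (t' == t) && (v' == v) then z else tab m t' v'.
Proof.
move=> ht ht'; rewrite /tab /tset.
have -> : (v' * 8 + t'%:Z == v * 8 + t%:Z) = (t' == t) && (v' == v) by lia.
by [].
Qed.

(* Registers: 0 = n, 4 = 1, 5 = 8, 6 = multiplier [a], 7 = modulus [M],
   8 = Merlin's bucket [rr], 9 = number [B] of buckets, 10 = bucket width [D],
   11 = sign, 12 and 13 = offsets of the two input arrays of the phase. *)
Definition hash (d x : nat) : seq instr :=
  [:: IMul d 6 x; IMod d d 7; IDiv d d 10].

(** Horner's scheme from the last bit down, so bit 0 is the least significant. The powers of two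
    collected in [pow] supply the modulus [M] and the number [B] of buckets. *)
Definition readbits (rd : nat -> nat -> instr) (len acc pow : nat) : com :=
  Seq (Block [:: IConst 20 0; IAdd 20 20 len; IConst acc 0; IConst pow 1])
      (While 20 (Block [:: ISub 20 20 4; rd 21%N 20%N; IAdd acc acc acc;
                           IAdd acc acc 21; IAdd pow pow pow])).

(* Tables of phase [q]: list heads, list successors, values of the first array
   already treated, sums found. *)
Definition tH (q : bool) : nat := if q then 4 else 0.
Definition tN (q : bool) : nat := if q then 5 else 1.
Definition tS (q : bool) : nat := if q then 6 else 2.
Definition tM (q : bool) : nat := if q then 7 else 3.

(** Indices are pushed in decreasing order, so each bucket list comes out increasing.
    Zero-initialised memory represents empty lists. *)
Definition build (q : bool) : com :=
  Seq (Block [:: IConst 20 0; IAdd 20 20 0])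
      (While 20 (Block
         ([:: ISub 20 20 4; IAdd 21 20 13; IInput 22 21; IMul 22 22 11]
          ++ hash 23 22 ++ tload 24 23 (tH q) ++ tstore 20 (tN q) 24
          ++ [:: IAdd 24 20 4] ++ tstore 23 (tH q) 24))).

(** Each sum is marked in the table of its own phase and looked up in that of the other. During the
    first phase the other table is still empty, so only the second phase can accept. *)
Definition inner (q : bool) : com :=
  Seq (Block ([:: ISub 21 26 4; IAdd 27 21 13; IInput 27 27; IMul 27 27 11;
                  IAdd 27 27 22]
              ++ tstore 27 (tM q) 4 ++ tload 24 27 (tM (~~ q))))
      (Seq (IfNZ 24 (Block [:: IAccept])) (Block (tload 26 21 (tN q)))).

Definition visit (q : bool) : com :=
  Seq (Block ([:: IMod 25 28 9] ++ tload 26 25 (tH q))) (While 26 (inner q)).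

(** The two visits correspond to the two possible carries in the addition of buckets. *)
Definition treat (q : bool) : com :=
  Seq (Block (tstore 22 (tS q) 4 ++ hash 23 22 ++ [:: ISub 28 8 23]))
      (Seq (visit q) (Seq (Block [:: ISub 28 28 4]) (visit q))).

(** Register 24 ends up as one minus the flag of the value, so a repeated value is skipped; without
    this, repetitions could make the cost quadratic. *)
Definition scan (q : bool) : com :=
  Seq (Block [:: IConst 20 0; IAdd 20 20 0])
      (While 20
         (Seq (Block ([:: ISub 20 20 4; IAdd 21 20 12; IInput 22 21; IMul 22 22 11]
                      ++ tload 24 22 (tS q) ++ [:: ISub 24 4 24]))
              (IfNZ 24 (treat q)))).

(** The sign makes the second phase work on [-A3] and [-A4], which turns a solution into an equality
    between sums of the two phases. *)
Definition setup (q : bool) : com :=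
  Block (if q then [:: IConst 11 (-1); IAdd 12 0 0; IAdd 13 12 0]
         else [:: IConst 11 1; IConst 12 0; IAdd 13 12 0]).

Definition phase (q : bool) : com := Seq (setup q) (Seq (build q) (scan q)).

Definition verifier : com :=
  Seq (Block [:: IConst 4 1; IConst 5 8])
  (Seq (readbits IRand 1 6 7)
  (Seq (readbits IProof 2 8 9)
  (Seq (Block [:: IDiv 10 7 9])
  (Seq (phase false) (Seq (phase true) (Block [:: IReject])))))).

(** * Correctness and running time of the verifier *)

Section Phase.
Variables (P : seq instr) (W : nat) (inp : seq int) (rnd prf : seq bool).
Variable Post : bool -> nat -> Prop.
Variables (q : bool) (n X : nat) (a M rr B D sg oX oY : int).

Hypothesis inpX : forall i, `|nth_at 0 inp i| <= X%:Z.
Hypotheses (a0 : 0 <= a) (aM : a <= M) (M0 : 0 < M) (B0 : 0 < B) (D0 : 0 < D).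
Hypotheses (rr0 : 0 <= rr) (rrB : rr < B).
Hypotheses (oX0 : 0 <= oX <= 4 * n%:Z) (oY0 : 0 <= oY <= 4 * n%:Z).
Hypothesis sg1 : `|sg| = 1.
(** The factor 100 leaves room for table addresses [8 * v + t], where [v] is a value, a sum of two
    values, an index or a bucket. *)
Hypotheses (WX : 100 * X%:Z <= W%:Z) (Wn : 100 * n%:Z <= W%:Z).
Hypotheses (WM : 100 * M <= W%:Z) (WB : 100 * B <= W%:Z).
Hypotheses (W100 : 100 <= W%:Z) (WMX : M * X%:Z <= W%:Z).

Lemma inpW i : `|nth_at 0 inp i| <= W%:Z.
Proof. by apply: le_trans (inpX i) _; lia. Qed.

Local Notation wpp := (wp P W inp rnd prf Post).

Definition env (R : nat -> int) : Prop :=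
  [/\ R 0%N = n%:Z, R 4%N = 1, R 5%N = 8, R 6%N = a & R 7%N = M] /\
  [/\ R 8%N = rr, R 9%N = B & R 10%N = D] /\
  [/\ R 11%N = sg, R 12%N = oX & R 13%N = oY].

Lemma envE R : env R ->
  (R 0%N = n%:Z) * (R 4%N = 1) * (R 5%N = 8) * (R 6%N = a) * (R 7%N = M) *
  (R 8%N = rr) * (R 9%N = B) * (R 10%N = D) *
  (R 11%N = sg) * (R 12%N = oX) * (R 13%N = oY).
Proof. by move=> [[-> -> -> -> ->] [[-> -> ->] [-> -> ->]]]. Qed.

Lemma wp_tload bk Q T R m d v t : R 5%N = 8 -> (t < 8)%N -> v != 15%N ->
  `|R v| * 8 + 8 <= W%:Z -> `|tab m t (R v)| <= W%:Z ->
  wpp (Block bk) Q (State (T + 4)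
    (upd (upd (upd (upd R 15 t%:Z) 16 (R v * 8)) 16 (R v * 8 + t%:Z))
       d (tab m t (R v))) m) ->
  wpp (Block (tload d v t ++ bk)) Q (State T R m).
Proof.
move=> h5 ht hv b1 b2 w.
apply: wp_const; first by lia.
apply: wp_mul; rewrite !updE (negbTE hv) /= h5; first by lia.
apply: wp_add; rewrite !updE /=; first by lia.
apply: wp_load; rewrite !updE /=; first by [].
by move: w; rewrite addn4.
Qed.

Lemma wp_tstore bk Q T R m v t b : R 5%N = 8 -> (t < 8)%N -> v != 15%N ->
  b != 15%N -> b != 16%N -> `|R v| * 8 + 8 <= W%:Z ->
  wpp (Block bk) Q (State (T + 4)
    (upd (upd (upd R 15 t%:Z) 16 (R v * 8)) 16 (R v * 8 + t%:Z))
    (tset m t (R v) (R b))) ->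
  wpp (Block (tstore v t b ++ bk)) Q (State T R m).
Proof.
move=> h5 ht hv hb1 hb2 b1 w.
apply: wp_const; first by lia.
apply: wp_mul; rewrite !updE (negbTE hv) /= h5; first by lia.
apply: wp_add; rewrite !updE /=; first by lia.
apply: wp_store; rewrite !updE (negbTE hb1) (negbTE hb2) /=.
by move: w; rewrite addn4.
Qed.

Definition bucket (x : int) : int := (((a * x) %% M)%Z %/ D)%Z.

Lemma bucket_bound x : 0 <= bucket x <= M.
Proof.
have h1 : 0 <= ((a * x) %% M)%Z < M by lia.
rewrite /bucket divz_ge0 //; have := lez_div ((a * x) %% M)%Z D; lia.
Qed.

Lemma mul_bound x : `|x| <= X%:Z -> `|a * x| <= W%:Z.
Proof.
move=> hx; rewrite normrM; apply: le_trans WMX.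
by apply: ler_pM => //; lia.
Qed.

Lemma wp_hash bk Q T R m d x : (15 < d)%N -> env R -> `|R x| <= X%:Z ->
  wpp (Block bk) Q (State (T + 3)
    (upd (upd (upd R d (a * R x)) d ((a * R x) %% M)%Z) d (bucket (R x))) m) ->
  wpp (Block (hash d x ++ bk)) Q (State T R m).
Proof.
move=> hd hR hx w; have E := envE _ hR.
have n7 : (7%N == d) = false by lia.
have n10 : (10%N == d) = false by lia.
apply: wp_mul; rewrite !E; first exact: mul_bound.
apply: wp_mod; rewrite !updE eqxx n7 !E; first by lia.
apply: wp_div; rewrite !updE eqxx n10 !E; first by have := bucket_bound (R x); rewrite /bucket; lia.
by move: w; rewrite addn3.
Qed.

Definition Xv (i : nat) : int := sg * nth_at 0 inp (i%:Z + oX).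
Definition Yv (j : nat) : int := sg * nth_at 0 inp (j%:Z + oY).

Lemma Xv_bound i : `|Xv i| <= X%:Z.
Proof. by rewrite /Xv normrM sg1 mul1r. Qed.

Lemma Yv_bound i : `|Yv i| <= X%:Z.
Proof. by rewrite /Yv normrM sg1 mul1r. Qed.

(* A linked list of indices: the pointer [j + 1] stands for [j], and 0 for nil. *)
Fixpoint chain (m : int -> int) (p : int) (js : seq nat) : Prop :=
  match js with
  | [::] => p = 0
  | j :: js' => p = j.+1%:Z /\ chain m (tab m (tN q) j%:Z) js'
  end.

Lemma chain_ext m m' p js :
  (forall j, j \in js -> tab m' (tN q) j%:Z = tab m (tN q) j%:Z) ->
  chain m p js -> chain m' p js.
Proof.
elim: js p => [|j js IH] p //= h [-> c]; split=> //.
rewrite h ?mem_head //; apply: IH => // i hi; apply: h.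
by rewrite in_cons hi orbT.
Qed.

Lemma chain_bound m p js : all (fun j => j < n)%N js -> chain m p js ->
  `|p| <= n%:Z.
Proof. by case: js => [|j js] /=; [move=> _ ->; lia | move=> /andP[h _] [-> _]; lia]. Qed.

Definition marked (m m' : int -> int) (vs : seq int) : Prop :=
  forall t v, (t < 8)%N ->
    tab m' t v = if (t == tM q) && (v \in vs) then 1 else tab m t v.

Lemma tags : [/\ (tH q < 8)%N, (tN q < 8)%N, (tS q < 8)%N, (tM q < 8)%N
   & (tM (~~ q) < 8)%N].
Proof. by case: q. Qed.

(** Induction on the list, with 30 a generous step count for one iteration. The exit continuation
    may assume that no sum was marked by the other phase, since a marked one would have led to
    acceptance. *)
Lemma inner_wp x cnt z js Q t R m :
  env R -> R 20%N = cnt -> R 22%N = x -> R 28%N = z -> `|x| <= X%:Z ->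
  chain m (R 26%N) js -> all (fun j => j < n)%N js ->
  (forall v, `|tab m (tM (~~ q)) v| <= 1) ->
  (forall j t', j \in js -> tab m (tM (~~ q)) (x + Yv j) <> 0 ->
     (t' <= t + 30 * size js + 1)%N -> Post true t') ->
  (forall t' R' m', env R' -> R' 20%N = cnt -> R' 22%N = x -> R' 28%N = z ->
     marked m m' [seq x + Yv j | j <- js] ->
     (forall j, j \in js -> tab m (tM (~~ q)) (x + Yv j) = 0) ->
     (t' <= t + 30 * size js + 1)%N -> Q (State t' R' m')) ->
  wpp (While 26 (inner q)) Q (State t R m).
Proof.
have [hH hN hS hM hM'] := tags.
elim: js t R m => [|j js IH] t R m hR h20 h22 h28 hx.
  move=> /= h26 _ _ _ hQ; apply: wp_while => // _.
  by apply: hQ => //; [move=> t' v _; rewrite andbF | lia].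
move=> /= [h26 hc] /andP[hj hjs] hm hA hQ.
apply: wp_while => [|_]; first by lia.
have E := envE _ hR; have hy := Yv_bound j.
apply: wp_seq.
apply: wp_sub; rewrite ?updE /= ?E ?h26; first by lia.
apply: wp_add; rewrite ?updE /= ?E ?h26; first by lia.
have -> : j.+1%:Z - 1 = j%:Z by lia.
apply: wp_input; rewrite ?updE /= ?E; first exact: inpW.
apply: wp_mul; rewrite ?updE /= ?E ![_ * sg]mulrC -/(Yv j); first by lia.
apply: wp_add; rewrite ?updE /= ?h22 ![Yv j + _]addrC; first by lia.
apply: wp_tstore => //; rewrite ?updE /= ?E //; first by lia.
rewrite -[tload _ _ _]cats0.
have T1 v : tab (tset m (tM q) (x + Yv j) 1) (tM (~~ q)) v = tab m (tM (~~ q)) v.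
  by rewrite tab_tset //; case: (q).
apply: wp_tload => //; rewrite ?updE /= ?E ?T1 //; first by lia.
  by apply: le_trans (hm _) _; lia.
apply: wp_nil; apply: wp_seq; apply: wp_if => [|hne].
  rewrite updE /= => e0; rewrite -[tload _ _ _]cats0.
  have T2 v : tab (tset m (tM q) (x + Yv j) 1) (tN q) v = tab m (tN q) v.
    by rewrite tab_tset //; case: (q).
  have bj := chain_bound _ _ _ hjs hc.
  apply: wp_tload => //; rewrite ?updE /= ?E ?T2 //; first by lia.
    by lia.
  apply: wp_nil => /=; apply: IH => //.
  - by rewrite ?updE /=; apply: chain_ext hc => i _; rewrite T2.
  - by move=> v; rewrite T1.
  - move=> i t' hi; rewrite T1 => hv ht; apply: (hA i) => //; last by lia.
    by rewrite in_cons hi orbT.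
  - move=> t' R' m' hR' h20' h22' h28' hmk hz ht; apply: hQ => //; last by lia.
    + move=> t1 v ht1; rewrite hmk // tab_tset // in_cons.
      by case: (t1 =P tM q) => //= _; rewrite orbC; case: ifP.
    + move=> i; rewrite in_cons => /orP[/eqP ->//|hi].
      by rewrite -T1 hz.
apply: wp_accept; apply: (hA j) => //; first exact: mem_head.
by lia.
Qed.

Definition bkt (k : int) : seq nat := [seq j <- iota 0 n | bucket (Yv j) == k].

Definition lists (m : int -> int) : Prop := forall k, chain m (tab m (tH q) k) (bkt k).

Lemma bkt_lt k : all (fun j => j < n)%N (bkt k).
Proof. by apply/allP => j; rewrite mem_filter mem_iota add0n => /andP[_ /andP[]]. Qed.

Lemma marked_lists m m' vs : marked m m' vs -> lists m -> lists m'.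
Proof.
have [hH hN _ _ _] := tags => hm hl k.
have hH' : (tH q == tM q) = false by case: (q).
have hN' : (tN q == tM q) = false by case: (q).
rewrite hm // hH' /=; apply: chain_ext (hl k) => j _.
by rewrite hm // hN'.
Qed.

Lemma visit_wp x cnt z Q t R m :
  env R -> R 20%N = cnt -> R 22%N = x -> R 28%N = z -> `|x| <= X%:Z ->
  lists m -> (forall v, `|tab m (tM (~~ q)) v| <= 1) ->
  let js := bkt (z %% B)%Z in
  (forall v t', v \in [seq x + Yv j | j <- js] -> tab m (tM (~~ q)) v <> 0 ->
     (t' <= t + 30 * size js + 6)%N -> Post true t') ->
  (forall t' R' m', env R' -> R' 20%N = cnt -> R' 22%N = x -> R' 28%N = z ->
     marked m m' [seq x + Yv j | j <- js] ->
     (forall v, v \in [seq x + Yv j | j <- js] -> tab m (tM (~~ q)) v = 0) ->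
     (t' <= t + 30 * size js + 6)%N -> Q (State t' R' m')) ->
  wpp (visit q) Q (State t R m).
Proof.
have [hH hN hS hM hM'] := tags.
move=> hR h20 h22 h28 hx hl hm js hA hQ.
have E := envE _ hR; have hb := chain_bound _ _ _ (bkt_lt (z %% B)%Z) (hl (z %% B)%Z).
have hzB : 0 <= (z %% B)%Z < B by lia.
apply: wp_seq; apply: wp_mod; rewrite ?E ?h28; first by lia.
rewrite -[tload _ _ _]cats0; apply: wp_tload => //; rewrite ?updE /= ?E ?h28 //.
- by lia.
- by lia.
apply: wp_nil; apply: (inner_wp x cnt z js) => //.
- by rewrite updE /=; exact: hl.
- exact: bkt_lt.
- move=> j t' hj h1 h2; apply: (hA (x + Yv j)) => //; last by lia.
  by apply/mapP; exists j.
- move=> t' R' m' hR' h20' h22' h28' hmk hz ht; apply: hQ => //; last by lia.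
  by move=> v /mapP[j hj ->]; exact: hz.
Qed.

Definition vis (x : int) : seq int :=
  [seq x + Yv j | j <- bkt ((rr - bucket x) %% B)%Z]
  ++ [seq x + Yv j | j <- bkt ((rr - bucket x - 1) %% B)%Z].

Lemma treat_wp x cnt Q t R m :
  env R -> R 20%N = cnt -> R 22%N = x -> `|x| <= X%:Z ->
  lists m -> (forall v, `|tab m (tM (~~ q)) v| <= 1) ->
  (forall v t', v \in vis x -> tab m (tM (~~ q)) v <> 0 ->
     (t' <= t + 30 * size (vis x) + 30)%N -> Post true t') ->
  (forall t' R' m', env R' -> R' 20%N = cnt -> lists m' ->
     (forall t v, (t < 8)%N -> tab m' t v =
        if (t == tM q) && (v \in vis x) then 1
        else if (t == tS q) && (v == x) then 1 else tab m t v) ->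
     (forall v, v \in vis x -> tab m (tM (~~ q)) v = 0) ->
     (t' <= t + 30 * size (vis x) + 30)%N -> Q (State t' R' m')) ->
  wpp (treat q) Q (State t R m).
Proof.
have [hH hN hS hM hM'] := tags.
move=> hR h20 h22 hx hl hm hA hQ; have E := envE _ hR.
have hsz : size (vis x) = (size (bkt ((rr - bucket x) %% B)%Z)
    + size (bkt ((rr - bucket x - 1) %% B)%Z))%N by rewrite size_cat !size_map.
have bb := bucket_bound x.
apply: wp_seq; rewrite /treat.
apply: wp_tstore; rewrite ?E ?h22 //; first by lia.
set m1 := tset _ _ _ _.
have T1 t1 v : (t1 < 8)%N -> tab m1 t1 v =
    if (t1 == tS q) && (v == x) then 1 else tab m t1 v.
  by move=> h1; rewrite tab_tset.
have nS t1 : t1 \in [:: tH q; tN q; tM (~~ q)] -> (t1 == tS q) = false.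
  by rewrite !inE => /or3P[]/eqP->; case: (q).
have l1 : lists m1.
  move=> k; rewrite T1 // nS ?inE ?eqxx //=.
  by apply: chain_ext (hl k) => j _; rewrite T1 // nS ?inE ?eqxx ?orbT.
have mM v : tab m1 (tM (~~ q)) v = tab m (tM (~~ q)) v.
  by rewrite T1 // nS ?inE ?eqxx ?orbT.
apply: wp_hash => //; first by rewrite !updE /= h22.
rewrite !updE /= h22.
apply: wp_sub; rewrite ?updE /= ?E; first by lia.
apply: wp_nil; apply: wp_seq; apply: (visit_wp x cnt (rr - bucket x)) => //=.
- by move=> v; rewrite mM.
- move=> v t' hv; rewrite mM => hv0 ht'; apply: (hA v) => //; last by lia.
  by rewrite mem_cat hv.
move=> t1 R1 m2 hR1 h20_1 h22_1 h28_1 hmk1 hz1 ht1; have E1 := envE _ hR1.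
have mM2 v : tab m2 (tM (~~ q)) v = tab m (tM (~~ q)) v.
  by rewrite hmk1 // -mM; case: (q).
apply: wp_seq; apply: wp_sub; rewrite ?h28_1 ?E1; first by lia.
apply: wp_nil; apply: (visit_wp x cnt (rr - bucket x - 1)) => //=.
- exact: marked_lists hmk1 _.
- by move=> v; rewrite mM2.
- move=> v t' hv; rewrite mM2 => hv0 ht'; apply: (hA v) => //; last by lia.
  by rewrite mem_cat hv orbT.
move=> t2 R2 m3 hR2 h20_2 h22_2 h28_2 hmk2 hz2 ht2; apply: hQ => //.
- apply: marked_lists hmk2 _; exact: marked_lists hmk1 _.
- move=> t3 v h3; rewrite hmk2 // hmk1 // T1 // mem_cat.
  by case: (t3 == tM q) => //=; rewrite orbC; case: (v \in _).
- move=> v; rewrite mem_cat => /orP[/hz1|/hz2]; first by rewrite mM.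
  by rewrite mM2.
- by lia.
Qed.

(** The scan runs downwards: at counter [c], [xs c] and [vals c] describe what has been met so far,
    whereas [cost c] measures the work still ahead. *)
Definition xs (c : nat) : seq int := [seq Xv i | i <- iota c (n - c)].
Definition vals (c : nat) : seq int := flatten [seq vis (Xv i) | i <- iota c (n - c)].
Definition cost (c : nat) : nat :=
  (\sum_(i < c) (if Xv i \in xs i.+1 then 0 else size (vis (Xv i))))%N.

Lemma xsS c : (c < n)%N -> xs c = Xv c :: xs c.+1.
Proof. by move=> h; rewrite /xs (_ : n - c = (n - c.+1).+1)%N //; lia. Qed.

Lemma valsS c : (c < n)%N -> vals c = vis (Xv c) ++ vals c.+1.
Proof. by move=> h; rewrite /vals (_ : n - c = (n - c.+1).+1)%N //; lia. Qed.

Lemma vis_vals i c v : (c <= i < n)%N -> v \in vis (Xv i) -> v \in vals c.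
Proof.
move=> hi hv; apply/flattenP; exists (vis (Xv i)) => //.
by apply/mapP; exists i; rewrite // mem_iota; clear -hi; lia.
Qed.

(** Justifies skipping a repeated value: the equal entry at a larger index has already produced the
    same sums. *)
Lemma xs_vis c v : Xv c \in xs c.+1 -> v \in vis (Xv c) -> v \in vals c.+1.
Proof.
move=> /mapP[i]; rewrite mem_iota => hi -> hv.
by apply: vis_vals hv; lia.
Qed.

(** The invariant makes the two tables the indicators of [xs c] and [vals c], with no sum so far
    marked by the other phase. Time is charged as 50 steps per index and 30 per visited
    candidate. *)
Lemma scan_loop Q c t R m :
  env R -> R 20%N = c%:Z -> (c <= n)%N -> lists m ->
  (forall v, `|tab m (tM (~~ q)) v| <= 1) ->
  (forall v, tab m (tS q) v = ((v \in xs c) : nat)%:Z) ->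
  (forall v, tab m (tM q) v = ((v \in vals c) : nat)%:Z) ->
  (forall v, v \in vals c -> tab m (tM (~~ q)) v = 0) ->
  (forall v t', v \in vals 0 -> tab m (tM (~~ q)) v <> 0 ->
     (t' <= t + 50 * c + 30 * cost c + 1)%N -> Post true t') ->
  (forall t' R' m', env R' ->
     (forall v, tab m' (tM q) v = ((v \in vals 0) : nat)%:Z) ->
     (forall v, v \in vals 0 -> tab m (tM (~~ q)) v = 0) ->
     (forall t v, (t < 8)%N -> t != tS q -> t != tM q -> tab m' t v = tab m t v) ->
     (t' <= t + 50 * c + 30 * cost c + 1)%N -> Q (State t' R' m')) ->
  wpp (While 20 (Seq (Block ([:: ISub 20 20 4; IAdd 21 20 12; IInput 22 21; IMul 22 22 11]
                      ++ tload 24 22 (tS q) ++ [:: ISub 24 4 24]))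
              (IfNZ 24 (treat q)))) Q (State t R m).
Proof.
have [hH hN hS hM hM'] := tags.
elim: c t R m => [|c IH] t R m hR h20 hc hl hm hs hk hz hA hQ.
  apply: wp_while => // _; apply: hQ => //; lia.
have E := envE _ hR; have hX := Xv_bound c.
apply: wp_while => [|_]; first by lia.
apply: wp_seq.
apply: wp_sub; rewrite ?updE /= ?E ?h20; first by lia.
have -> : c.+1%:Z - 1 = c%:Z by lia.
apply: wp_add; rewrite ?updE /= ?E; first by lia.
apply: wp_input; rewrite ?updE /= ?E; first exact: inpW.
apply: wp_mul; rewrite ?updE /= ?E ![_ * sg]mulrC -/(Xv c); first by lia.
apply: wp_tload => //; rewrite ?updE /= ?E //; first by lia.
  by rewrite hs; case: (_ \in _); lia.
apply: wp_sub; rewrite ?updE /= ?E hs; first by case: (_ \in _); lia.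
have xsC := xsS _ hc; have vC := valsS _ hc.
have cC : cost c.+1 = (cost c + if Xv c \in xs c.+1 then 0 else size (vis (Xv c)))%N.
  by rewrite /cost big_ord_recr.
apply: wp_nil; apply: wp_if; rewrite updE /=.
  case hin: (Xv c \in xs c.+1) => //= _; rewrite hin in cC.
  have vE v : (v \in vals c) = (v \in vals c.+1).
    by rewrite vC [v \in _ ++ vals _]mem_cat; case hv: (v \in vis _) => //=; rewrite (xs_vis _ _ hin hv).
  apply: IH => //.
  - exact: ltnW.
  - by move=> v; rewrite hs xsC in_cons; case: eqP => // ->; rewrite hin.
  - by move=> v; rewrite hk vE.
  - by move=> v; rewrite vE; exact: hz.
  - move=> v t' h1 h2 h3; apply: (hA v) => //; lia.
  - move=> t' R' m' h1 h2 h3 h4 h5; apply: hQ => //; lia.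
case hin: (Xv c \in xs c.+1) => //= _; rewrite hin in cC.
apply: (treat_wp (Xv c) c%:Z) => //=.
  move=> v t' hv h1 h2; apply: (hA v) => //; last by lia.
  by apply: (vis_vals c) => //; lia.
move=> t1 R1 m1 hR1 h20_1 l1 T1 z1 ht1.
have mM v : tab m1 (tM (~~ q)) v = tab m (tM (~~ q)) v.
  by rewrite T1 //; case: (q).
apply: IH => //=.
- exact: ltnW.
- by move=> v; rewrite mM.
- move=> v; rewrite T1 // hs eqxx xsC in_cons.
  have -> : (tS q == tM q) = false by case: (q).
  by case: (v == Xv c).
- move=> v; rewrite T1 // hk eqxx vC [v \in _ ++ vals _]mem_cat /=.
  have -> : (tM q == tS q) = false by case: (q).
  by case: (v \in vis _).
- by move=> v; rewrite mM vC [v \in _ ++ vals _]mem_cat => /orP[/z1|/hz].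
- move=> v t' h1; rewrite mM => h2 h3; apply: (hA v) => //; lia.
- move=> t' R' m' h1 h2 h3 h4 h5; apply: hQ => //; last by lia.
  + by move=> v /h3; rewrite mM.
  + move=> t2 v h6 h7 h8; rewrite h4 // T1 //.
    by rewrite (negbTE h7) (negbTE h8).
Qed.

Lemma build_loop Q c t R m :
  env R -> R 20%N = c%:Z -> (c <= n)%N ->
  (forall k, chain m (tab m (tH q) k)
     [seq j <- iota c (n - c) | bucket (Yv j) == k]) ->
  (forall t' R' m', env R' -> lists m' ->
     (forall t v, (t < 8)%N -> t != tH q -> t != tN q -> tab m' t v = tab m t v) ->
     (t' <= t + 30 * c + 1)%N -> Q (State t' R' m')) ->
  wpp (While 20 (Block
         ([:: ISub 20 20 4; IAdd 21 20 13; IInput 22 21; IMul 22 22 11]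
          ++ hash 23 22 ++ tload 24 23 (tH q) ++ tstore 20 (tN q) 24
          ++ [:: IAdd 24 20 4] ++ tstore 23 (tH q) 24))) Q (State t R m).
Proof.
have [hH hN hS hM hM'] := tags.
elim: c t R m => [|c IH] t R m hR h20 hc hl hQ.
  apply: wp_while => // _; apply: hQ => //; last by lia.
  by move=> k; have := hl k; rewrite subn0.
have E := envE _ hR; have hy := Yv_bound c.
have bb := bucket_bound (Yv c).
have hlt k : all (fun j => j < n)%N [seq j <- iota c.+1 (n - c.+1) | bucket (Yv j) == k].
  by apply/allP => j; rewrite mem_filter mem_iota; lia.
have hb k := chain_bound _ _ _ (hlt k) (hl k).
apply: wp_while => [|_]; first by lia.
apply: wp_sub; rewrite ?updE /= ?E ?h20; first by lia.
have -> : c.+1%:Z - 1 = c%:Z by lia.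
apply: wp_add; rewrite ?updE /= ?E; first by lia.
apply: wp_input; rewrite ?updE /= ?E; first exact: inpW.
apply: wp_mul; rewrite ?updE /= ?E ![_ * sg]mulrC -/(Yv c); first by lia.
apply: wp_hash => //; rewrite !updE /=.
apply: wp_tload => //; rewrite ?updE /= ?E //; first by lia.
  by apply: le_trans (hb _) _; lia.
apply: wp_tstore => //; rewrite ?updE /= ?E //; first by lia.
apply: wp_add; rewrite ?updE /= ?E; first by lia.
rewrite -[tstore 23%N _ _]cats0; apply: wp_tstore => //; rewrite ?updE /= ?E //; first by lia.
set h := bucket (Yv c) in bb *; set m1 := tset m _ _ _; set m2 := tset m1 _ _ _.
have nHN : (tH q == tN q) = false by case: (q).
have T2 t1 v : (t1 < 8)%N -> tab m2 t1 v =
   if (t1 == tH q) && (v == h) then c.+1%:Z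
   else if (t1 == tN q) && (v == c%:Z) then tab m (tH q) h else tab m t1 v.
  move=> h1; rewrite /m2 /m1 !tab_tset //.
  by have -> : c%:Z + 1 = c.+1%:Z by lia.
apply: wp_nil; apply: IH => //=.
- exact: ltnW.
- have -> : (n - c = (n - c.+1).+1)%N by lia.
  move=> k /=.
  (* The new link is stored in cell [c], which no older list uses, as their indices all exceed
     [c]. *)
  have hc2 : chain m2 (tab m (tH q) k) [seq j <- iota c.+1 (n - c.+1) | bucket (Yv j) == k].
    apply: chain_ext (hl k) => j; rewrite mem_filter mem_iota => /andP[_ hj].
    rewrite T2 // eqxx eq_sym nHN /=.
    by have -> : (j%:Z == c%:Z) = false by lia.
  rewrite T2 // eqxx -/h /= eq_sym; case: (h =P k) => [e|ne] /=.
    split=> //; rewrite T2 // eq_sym nHN /= !eqxx /= e; exact: hc2.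
  by rewrite nHN.
- move=> t' R' m' h1 h2 h3 h4; apply: hQ => //; last by lia.
  move=> t1 v h5 h6 h7; rewrite h3 // T2 //.
  by rewrite (negbTE h6) (negbTE h7).
Qed.

Lemma build_scan_wp Q t R m :
  env R ->
  (forall t v, t \in [:: tH q; tN q; tS q; tM q] -> tab m t v = 0) ->
  (forall v, `|tab m (tM (~~ q)) v| <= 1) ->
  (forall v t', v \in vals 0 -> tab m (tM (~~ q)) v <> 0 ->
     (t' <= t + 80 * n + 30 * cost n + 6)%N -> Post true t') ->
  (forall t' R' m', env R' ->
     (forall v, tab m' (tM q) v = ((v \in vals 0) : nat)%:Z) ->
     (forall v, v \in vals 0 -> tab m (tM (~~ q)) v = 0) ->
     (forall t v, (t < 8)%N -> t \notin [:: tH q; tN q; tS q; tM q] ->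
         tab m' t v = tab m t v) ->
     (t' <= t + 80 * n + 30 * cost n + 6)%N -> Q (State t' R' m')) ->
  wpp (Seq (build q) (scan q)) Q (State t R m).
Proof.
have [hH hN hS hM hM'] := tags.
move=> hR h0 hm hA hQ; have E := envE _ hR.
apply: wp_seq; apply: wp_seq; apply: wp_const; first by lia.
apply: wp_add; rewrite ?updE /= ?E add0r; first by lia.
apply: wp_nil; apply: (build_loop _ n) => //=.
  by move=> k; rewrite subnn /= h0 // inE eqxx.
move=> t1 R1 m1 hR1 l1 T1 ht1; have E1 := envE _ hR1.
apply: wp_seq; apply: wp_const; first by lia.
apply: wp_add; rewrite ?updE /= ?E1 add0r; first by lia.
have mM v : tab m1 (tM (~~ q)) v = tab m (tM (~~ q)) v by rewrite T1 //; case: (q).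
apply: wp_nil; apply: (scan_loop _ n) => //=.
- by move=> v; rewrite mM.
- move=> v; rewrite T1 //; [|by case: (q)|by case: (q)].
  by rewrite h0 /xs ?subnn // !inE eqxx !orbT.
- move=> v; rewrite T1 //; [|by case: (q)|by case: (q)].
  by rewrite h0 /vals ?subnn // !inE eqxx !orbT.
- by move=> v; rewrite /vals subnn.
- by move=> v t' h1; rewrite mM => h2 h3; apply: (hA v) => //; lia.
- move=> t' R' m' h1 h2 h3 h4 h5; apply: hQ => //; last by lia.
  + by move=> v /h3; rewrite mM.
  + move=> t2 v h6; rewrite !inE !negb_or => /and4P[n1 n2 n3 n4].
    by rewrite h4 // T1.
Qed.

End Phase.

(** * Reading binary numbers *)

Fixpoint bval (s : seq bool) : nat :=
  if s is b :: s' then (b + 2 * bval s')%N else 0%N.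

Lemma bval_lt s : (bval s < 2 ^ size s)%N.
Proof. by elim: s => //= b s IH; rewrite expnS; case: b; lia. Qed.

Section ReadBits.
Variables (P : seq instr) (W : nat) (inp : seq int) (rnd prf : seq bool).
Variable Post : bool -> nat -> Prop.
Local Notation wpp := (wp P W inp rnd prf Post).

(** The read instruction is abstract so that random bits and proof bits are treated at once.
    Register 3 is among the changed ones because of the loop's backward jump. *)
Lemma readbits_wp (rd : nat -> nat -> instr) (s : seq bool) (len acc pow : nat) Q t R m :
  (forall bk Q' t R m d a,
     wpp (Block bk) Q' (State t.+1 (upd R d (nth_at false s (R a) : nat)%:Z) m) ->
     wpp (Block (rd d a :: bk)) Q' (State t R m)) ->
  (4 < acc)%N -> (acc < pow)%N -> (pow < 20)%N -> (len < 3)%N ->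
  R 4%N = 1 -> R len = (size s)%:Z ->
  (size s <= W)%N -> (2 ^ size s * 2 <= W)%N ->
  (forall t' R', R' acc = (bval s)%:Z -> R' pow = (2 ^ size s)%N%:Z ->
     (forall i, i \notin [:: 3; 20; 21; acc; pow]%N -> R' i = R i) ->
     (t' <= t + 10 * size s + 5)%N -> Q (State t' R' m)) ->
  wpp (readbits rd len acc pow) Q (State t R m).
Proof.
move=> hrd h1 h2 h3 hlen h4 hR hW1 hW2 hQ.
have l20 : (len == 20%N) = false by lia.
have acc20 : (acc == 20%N) = false by lia.
have acc21 : (acc == 21%N) = false by lia.
have pow20 : (pow == 20%N) = false by lia.
have pow21 : (pow == 21%N) = false by lia.
have pow_acc : (pow == acc) = false by lia.
have acc_pow : (acc == pow) = false by lia.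
have n4a : (4%N == acc) = false by lia.
have n4p : (4%N == pow) = false by lia.
have n20a : (20%N == acc) = false by lia.
have n20p : (20%N == pow) = false by lia.
have n21a : (21%N == acc) = false by lia.
have n21p : (21%N == pow) = false by lia.
have hps : (0 < 2 ^ size s)%N by rewrite expn_gt0.
pose zz := (l20, acc20, acc21, pow20, pow21, pow_acc, acc_pow, n4a, n4p, n20a, n20p,
  n21a, n21p, eqxx).
have loop c t1 R1 : (c <= size s)%N -> R1 20%N = c%:Z -> R1 4%N = 1 ->
    R1 acc = (bval (drop c s))%:Z -> R1 pow = (2 ^ (size s - c))%N%:Z ->
    (forall i, i \notin [:: 3; 20; 21; acc; pow]%N -> R1 i = R i) ->
    (t1 + 10 * c + 1 <= t + 10 * size s + 5)%N ->
    wpp (While 20 (Block [:: ISub 20 20 4; rd 21%N 20%N; IAdd acc acc acc;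
                           IAdd acc acc 21; IAdd pow pow pow])) Q (State t1 R1 m).
  elim: c t1 R1 => [|c IH] t1 R1 hc e20 e4 eacc epow eR ht.
    apply: wp_while => // _; apply: hQ => //; last by lia.
      by rewrite eacc drop0.
    by rewrite epow subn0.
  have hb : (bval (drop c.+1 s) < 2 ^ size s)%N.
    apply: leq_trans (bval_lt _) _; rewrite leq_exp2l // size_drop; lia.
  have hp : (2 ^ (size s - c) <= 2 ^ size s)%N by rewrite leq_exp2l //; lia.
  have hpS : (2 ^ (size s - c) = 2 * 2 ^ (size s - c.+1))%N.
    by rewrite -expnS; congr expn; lia.
  have hd : bval (drop c s) = (nth false s c + 2 * bval (drop c.+1 s))%N.
    by rewrite (drop_nth false).
  have hb' : (bval (drop c s) < 2 ^ size s)%N.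
    apply: leq_trans (bval_lt _) _; rewrite leq_exp2l // size_drop; lia.
  apply: wp_while => [|_]; first by lia.
  apply: wp_sub; rewrite ?updE /= ?e20 ?e4; first by lia.
  have -> : c.+1%:Z - 1 = c%:Z by lia.
  apply: hrd; rewrite updE /=.
  have -> : nth_at false s c%:Z = nth false s c by [].
  apply: wp_add; rewrite ?updE ?zz /= ?eacc; first by lia.
  apply: wp_add; rewrite ?updE ?zz /= ?eacc; first by lia.
  apply: wp_add; rewrite ?updE ?zz /= ?epow; first by lia.
  apply: wp_nil; apply: IH => //=; rewrite ?updE ?zz //=.
  - exact: ltnW.
  - by rewrite ifF; lia.
  - by rewrite ifF; lia.
  - move=> i hi; rewrite -eR // !updE; move: hi; rewrite !inE !negb_or.
    by move=> /and5P[/negbTE-> /negbTE-> /negbTE-> /negbTE-> /negbTE->].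
  - by lia.
apply: wp_seq; apply: wp_const; first by lia.
apply: wp_add; rewrite ?updE ?zz /= ?hR add0r; first by lia.
apply: wp_const; first by lia.
apply: wp_const; first by lia.
apply: wp_nil; apply: (loop (size s)) => //; rewrite ?updE ?zz //=.
- by rewrite drop_size.
- by rewrite subnn.
- move=> i hi; rewrite !updE; move: hi; rewrite !inE !negb_or.
  by move=> /and5P[_ /negbTE-> _ /negbTE-> /negbTE->].
- by lia.
Qed.

End ReadBits.

(** * A complete run of the verifier *)

Section Verifier.
Variables (W n X : nat) (inp : seq int) (rnd prf : seq bool).

Let a : int := (bval rnd)%:Z.
Let M : int := (2 ^ size rnd)%N%:Z.
Let rr : int := (bval prf)%:Z.
Let B : int := (2 ^ size prf)%N%:Z.
Let D : int := (M %/ B)%Z.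

Definition sgq (q : bool) : int := if q then -1 else 1.
Definition offX (q : bool) : int := if q then 2 * n%:Z else 0.
Definition offY (q : bool) : int := if q then 3 * n%:Z else n%:Z.

Definition sums (q : bool) : seq int :=
  vals inp n a M rr B D (sgq q) (offX q) (offY q) 0.
Definition visits (q : bool) : nat :=
  cost inp n a M rr B D (sgq q) (offX q) (offY q) n.

Definition time_bound : nat :=
  (100 + 10 * (size rnd + size prf) + 160 * n + 30 * (visits false + visits true))%N.

Hypothesis inpX : forall i, `|nth_at 0 inp i| <= X%:Z.
Hypothesis prf_rnd : (size prf <= size rnd)%N.
Hypotheses (WX : (100 * X <= W)%N) (Wn : (100 * n <= W)%N).
Hypotheses (WM : (100 * 2 ^ size rnd <= W)%N) (WMX : (2 ^ size rnd * X <= W)%N).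

(** Holds for every multiplier and every claimed bucket: a bad choice only affects the size of
    [time_bound] and of the lists. Soundness and completeness both rest on this exact description of
    the verdict. *)
Lemma verifier_halts : exists t b,
  [/\ forall f, run (compile 0 verifier) W inp rnd prf (t + f)
        (init_config n (size rnd) (size prf)) = Some b,
      (t <= time_bound)%N
    & b <-> exists2 v, v \in sums false & v \in sums true].
Proof.
pose Post (b : bool) (t : nat) := (t <= time_bound)%N /\
  (b <-> exists2 v, v \in sums false & v \in sums true).
set P := compile 0 verifier.
pose s0 := State 0 (fun i => if i == 0%N then n%:Z else if i == 1%N then (size rnd)%:Z
                     else if i == 2%N then (size prf)%:Z else 0) (fun _ => 0).
(* The exit condition is [False] because control never falls off the end of the program. *)
suff w : wp P W inp rnd prf Post verifier (fun _ => False) s0.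
  have hp : code_at P 0 (compile 0 verifier) by exists [::], [::]; rewrite cats0.
  have [//|t [b [h1 [h2 h3]]]] := w 0%N hp.
  by exists t, b.
have M0 : (0 < 2 ^ size rnd)%N by rewrite expn_gt0.
have B0 : (0 < 2 ^ size prf)%N by rewrite expn_gt0.
have BM : (2 ^ size prf <= 2 ^ size rnd)%N by rewrite leq_exp2l.
have hM := ltn_expl (size rnd) (isT : 1 < 2)%N.
have hB := ltn_expl (size prf) (isT : 1 < 2)%N.
have D0 : 0 < D by rewrite /D /M /B; lia.
have DM : D <= M by rewrite /D /M /B; have := lez_div M B; rewrite /M /B; lia.
have ab := bval_lt rnd; have rb := bval_lt prf.
apply: wp_seq; apply: wp_const; first by lia.
apply: wp_const; first by lia.
apply: wp_nil; apply: wp_seq; apply: (readbits_wp _ _ _ _ _ _ _ rnd) => //=.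
- by move=> *; apply: wp_rand => //; lia.
- by lia.
- by lia.
move=> t1 R1 e6 e7 eR1 ht1.
have e1 i : i \in [:: 0; 2; 4; 5]%N -> R1 i = [fun i => if i == 0%N then n%:Z
    else if i == 2%N then (size prf)%:Z else if i == 4%N then 1 else 8] i.
  by move=> hi; rewrite eR1; move: hi; rewrite !inE => /or4P[] /eqP-> //.
apply: wp_seq; apply: (readbits_wp _ _ _ _ _ _ _ prf) => //=.
- by move=> *; apply: wp_proof => //; lia.
- by rewrite e1.
- by rewrite e1.
- by lia.
- by lia.
move=> t2 R2 e8 e9 eR2 ht2.
apply: wp_seq; apply: wp_div; rewrite eR2 // e7 e9 -/M -/B -/D; first by lia.
apply: wp_nil.
set R3 := upd R2 10 D.
have e2 i : i \in [:: 0; 4; 5]%N -> R2 i = R1 i.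
  by move=> hi; rewrite eR2 //; move: hi; rewrite !inE => /or3P[] /eqP-> //.
have env3 sg oX oY : env n a M rr B D sg oX oY
    (upd (upd (upd R3 11 sg) 12 oX) 13 oY).
  rewrite /env /R3 !updE /= (e2 0%N) // (e2 4%N) // (e2 5%N) //.
  by rewrite (e1 0%N) // (e1 4%N) // (e1 5%N) // (eR2 6%N) // (eR2 7%N).
have hsg q : `|sgq q| = 1 by case: q.
have hoX q : 0 <= offX q <= 4 * n%:Z by case: q; rewrite /offX; lia.
have hoY q : 0 <= offY q <= 4 * n%:Z by case: q; rewrite /offY; lia.
apply: wp_seq; apply: wp_seq; rewrite /setup.
apply: wp_const; first by lia.
apply: wp_const; first by lia.
apply: wp_add; rewrite /R3 ?updE /= (e2 0%N) // (e1 0%N) //= add0r; first by lia.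
apply: wp_nil.
(* The memory is still zero, so the acceptance case of this phase is vacuous. *)
apply: (build_scan_wp _ _ _ _ _ _ false n X a M rr B D (sgq false) (offX false)
  (offY false)) => //; try by [rewrite /a /M /rr /B; lia].
move=> t4 R4 m4 env4 tM4 _ T4 ht4; rewrite -/(sums false) in tM4.
have E4 := envE _ _ _ _ _ _ _ _ _ _ env4.
apply: wp_seq; apply: wp_seq; rewrite /setup.
apply: wp_const; first by lia.
apply: wp_add; rewrite ?updE /= E4; first by lia.
apply: wp_add; rewrite ?updE /= E4; first by lia.
have -> : n%:Z + n%:Z = offX true by rewrite /offX; lia.
have -> : offX true + n%:Z = offY true by rewrite /offX /offY; lia.
apply: wp_nil.
apply: (build_scan_wp _ _ _ _ _ _ true n X a M rr B D (sgq true) (offX true)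
  (offY true)) => //; try by [rewrite /a /M /rr /B; lia].
- by rewrite /env !updE /= !E4; do ! split.
- by move=> t v; rewrite !inE => /or4P[]/eqP->; rewrite T4.
- by move=> v; rewrite tM4; case: (_ \in _).
- move=> v t' hv; rewrite tM4 => hv2 ht'; split; last first.
    split=> // _; exists v => //; by case: (v \in sums false) hv2.
  by move: ht' ht4; rewrite /time_bound /visits; lia.
move=> t5 R5 m5 _ _ hz _ ht5.
(* This point is reached only when no sum of the second phase was marked by the first, that is, when
   the two lists are disjoint. *)
apply: wp_reject; split.
  by move: ht5 ht4; rewrite /time_bound /visits; lia.
split=> // -[v h1 h2]; by have := hz v h2; rewrite tM4 h1.
Qed.

End Verifier.

(** * Almost linear hashing *)

Section Buckets.
Variables (M B D : int).
Hypotheses (MBD : M = D * B) (B0 : 0 < B) (D0 : 0 < D).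

Lemma bucket_range a x : 0 <= bucket a M D x < B.
Proof.
have M0 : 0 < M by rewrite MBD mulr_gt0.
have hm : 0 <= ((a * x) %% M)%Z < M by lia.
apply/andP; split; first by rewrite /bucket divz_ge0 //; lia.
by rewrite /bucket ltz_divLR // [B * D]mulrC -MBD; lia.
Qed.

(* The remainders modulo [D] contribute the carry [e], the reduction modulo [M]
   the multiple of [B]. *)
Lemma bucket_add_carry a x y :
  exists e k : int, (e = 0 \/ e = 1) /\
    bucket a M D y = bucket a M D (x + y) - bucket a M D x - e + k * B.
Proof.
have M0 : 0 < M by rewrite MBD mulr_gt0.
rewrite /bucket mulrDr -modzDm.
set u := ((a * x) %% M)%Z; set v := ((a * y) %% M)%Z.
have hu : 0 <= u < M by lia.
have hv : 0 <= v < M by lia.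
have [k [hk ->]] : exists k : int, (k = 0 \/ k = 1) /\ ((u + v) %% M)%Z = u + v - k * M.
  case: (ltP (u + v) M) => h.
    by exists 0; split; [left | rewrite mul0r subr0 modz_small //; lia].
  exists 1; split; first by right.
  rewrite mul1r -(modz_small (m := u + v - M) (d := M)); last by lia.
  by rewrite -[in LHS](subrK M (u + v)) modzDr.
set w := u + v - k * M.
have eu := divz_eq u D; have ev := divz_eq v D; have ew := divz_eq w D.
have ru : 0 <= (u %% D)%Z < D by lia.
have rv : 0 <= (v %% D)%Z < D by lia.
have rw : 0 <= (w %% D)%Z < D by lia.
move: (u %/ D)%Z (v %/ D)%Z (w %/ D)%Z eu ev ew => gu gv gw eu ev ew.
exists (gw - gu - gv + k * B), k; split; last by ring.
set e := gw - gu - gv + k * B.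
have he : e * D = (u %% D)%Z + (v %% D)%Z - (w %% D)%Z.
  have hw : w = u + v - k * (D * B) by rewrite -MBD.
  move: hw; rewrite {1}ew {1}eu {1}ev => hw.
  have -> : (w %% D)%Z = gu * D + (u %% D)%Z + (gv * D + (v %% D)%Z)
     - k * (D * B) - gw * D by rewrite -hw; ring.
  by rewrite /e; ring.
(* A combination of three remainders, [e * D] lies strictly between [- D] and [2 * D]. *)
have e2 : e < 2.
  by rewrite -(ltr_pM2r D0); lia.
have e1 : -1 < e.
  by rewrite -(ltr_pM2r D0); lia.
by lia.
Qed.

(** The bucket relation cancels all quotients; what remains is [- e * D] plus two remainders modulo
    [D] minus a third, which is below [2 * D] in absolute value for either carry. *)
Lemma near_collision a x y s e k :
  (e = 0 \/ e = 1) ->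
  bucket a M D y = bucket a M D s - bucket a M D x - e + k * B ->
  exists t, `|a * (x + y - s) - t * M| < 2 * D.
Proof.
move=> he hb.
have ex := divz_eq (a * x) M; have ey := divz_eq (a * y) M.
have es := divz_eq (a * s) M.
have dx := divz_eq ((a * x) %% M)%Z D; have dy := divz_eq ((a * y) %% M)%Z D.
have ds := divz_eq ((a * s) %% M)%Z D.
rewrite -/(bucket a M D x) in dx; rewrite -/(bucket a M D y) in dy.
rewrite -/(bucket a M D s) in ds.
exists (((a * x) %/ M)%Z + ((a * y) %/ M)%Z - ((a * s) %/ M)%Z + k).
have rx : 0 <= (((a * x) %% M)%Z %% D)%Z < D by lia.
have ry : 0 <= (((a * y) %% M)%Z %% D)%Z < D by lia.
have rs : 0 <= (((a * s) %% M)%Z %% D)%Z < D by lia.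
move: (((a * x) %% M)%Z %% D)%Z (((a * y) %% M)%Z %% D)%Z
  (((a * s) %% M)%Z %% D)%Z rx ry rs dx dy ds => rx' ry' rs' rx ry rs dx dy ds.
rewrite dx in ex; rewrite dy in ey; rewrite ds in es.
move: ((a * x) %/ M)%Z ((a * y) %/ M)%Z ((a * s) %/ M)%Z ex ey es => qx qy qs ex ey es.
have -> : a * (x + y - s) - (qx + qy - qs + k) * M = - e * D + rx' + ry' - rs'.
  rewrite mulrBr mulrDr ex ey es hb; move: (bucket _ _ _ s) (bucket _ _ _ x).
  by move=> gs gx; rewrite [in LHS]MBD; ring.
clear -he rx ry rs.
by case: he => ->; lia.
Qed.

End Buckets.

(** * Counting the multipliers that cause a collision *)

Lemma window_count (d D K N : nat) (p : pred 'I_N) :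
  (0 < d)%N -> (forall a, p a -> (K < a * d + 2 * D < K + 4 * D)%N) ->
  (#|[set a | p a]| <= (4 * D) %/ d + 1)%N.
Proof.
move=> d0 h.
(* Cut the window of length [4 * D] into blocks of length [d]: distinct multiples of [d] fall into
   distinct blocks. *)
pose f (a : 'I_N) : 'I_((4 * D) %/ d).+1 := inord ((a * d + 2 * D - K) %/ d).
have fE a : p a -> f a = ((a * d + 2 * D - K) %/ d)%N :> nat.
  by move=> pa; rewrite inordK // ltnS leq_div2r //; have := h a pa; lia.
have inj : {in [set a | p a] &, injective f}.
  move=> a b; rewrite !inE => pa pb e; apply: val_inj => /=.
  have : f a = f b :> nat by rewrite e.
  rewrite !fE // => {}e; have ha := h _ pa; have hb := h _ pb.
  have := divn_eq (a * d + 2 * D - K) d; have := divn_eq (b * d + 2 * D - K) d.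
  have := ltn_pmod (a * d + 2 * D - K) d0; have := ltn_pmod (b * d + 2 * D - K) d0.
  rewrite -e; move: (_ %/ d)%N (_ %% d)%N (_ %% d)%N => Q r1 r2 h1 h2 h3 h4.
  by nia.
rewrite -(card_in_imset inj); apply: leq_trans (max_card _) _.
by rewrite card_ord addn1.
Qed.

(** Since [0 <= a * d < d * M] and [D <= M], only the [d + 3] values of [t] from [-1] to [d + 1]
    occur, each with at most [4 * D / d + 1] multipliers. The product is at most
    [4 * D + 12 * D / d + d + 3], hence at most [20 * D]. *)
Lemma collision_count_nat (d D M : nat) (p : pred 'I_M) :
  (0 < d <= D)%N -> (D <= M)%N ->
  (forall a, p a -> exists t : int, `|(a * d)%N%:Z - t * M%:Z| < 2 * D%:Z) ->
  (#|[set a | p a]| <= 20 * D)%N.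
Proof.
move=> /andP[d0 dD] DM h.
(* The index [i] stands for [t = i - 1]; the shift by [M + 2 * D] keeps everything in the natural
   numbers. *)
pose S (i : 'I_(d + 3)) := [set a : 'I_M | (i * M < a * d + M + 2 * D < i * M + 4 * D)%N].
have sub : [set a | p a] \subset \bigcup_i S i.
  apply/subsetP => a; rewrite inE => /h[t ht]; have ha := ltn_ord a.
  have t1 : -1 <= t.
    case: (leP (-1) t) => // tlt; have : (t + 2) * M%:Z <= 0 by nia.
    by nia.
  have t2 : t <= d%:Z + 1.
    case: (leP t (d%:Z + 1)) => // tlt.
    have : (d%:Z + 2) * M%:Z <= t * M%:Z by nia.
    by nia.
  have ti : (absz (t + 1)%R < d + 3)%N by lia.
  apply/bigcupP; exists (Ordinal ti) => //; rewrite inE /=.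
  have : (absz (t + 1)%R * M)%N%:Z = t * M%:Z + M%:Z.
    by rewrite PoszM gez0_abs ?mulrDl ?mul1r //; lia.
  clear -ht; move: (absz _ * M)%N (a * d)%N (t * M%:Z) ht => k1 k2 k3; lia.
have cS i : (#|S i| <= (4 * D) %/ d + 1)%N.
  (* For [i = 0] the subtraction truncates to 0; this is harmless, as a natural number within
     [2 * D] of [- M] is also within [2 * D] of 0. *)
  apply: (window_count _ _ (i * M - M)%N) => // a.
  case: i => -[|i] hi /=; last by nia.
  by move=> ha; nia.
apply: leq_trans (subset_leq_card sub) _.
have cU : (#|\bigcup_i S i| <= \sum_(i < d + 3) #|S i|)%N.
  elim/big_rec2: _ => [|i m U _ IH]; first by rewrite cards0.
  by apply: leq_trans (leq_card_setU _ _) _; rewrite leq_add2l.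
apply: leq_trans cU _.
apply: (@leq_trans (\sum_(i < d + 3) ((4 * D) %/ d + 1))%N); first by apply: leq_sum.
rewrite sum_nat_const card_ord.
have := leq_trunc_div (4 * D) d; have := leq_div (4 * D) d.
by nia.
Qed.

Definition near (a M rr B D x y : int) : bool :=
  (bucket a M D y == ((rr - bucket a M D x) %% B)%Z)
  || (bucket a M D y == ((rr - bucket a M D x - 1) %% B)%Z).

(** The carry selects the branch, and the multiple of [B] disappears modulo [B] because buckets lie
    in [[0, B)]. *)
Lemma near_exact (M B D : int) : M = D * B -> 0 < B -> 0 < D ->
  forall a x y, near a M (bucket a M D (x + y)) B D x y.
Proof.
move=> MBD B0 D0 a x y; have r := bucket_range _ _ _ MBD B0 D0 a y.
have [e [k [he hk]]] := bucket_add_carry _ _ _ MBD B0 D0 a x y.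
have hr z : bucket a M D y = z + k * B -> bucket a M D y == (z %% B)%Z.
  by move=> h; rewrite -(modzMDl k) addrC -h modz_small //; lia.
apply/orP; case: he hk => -> hk; [left|right]; apply: hr; rewrite hk; lia.
Qed.

Lemma near_window (M B D : int) : M = D * B -> 0 < B -> 0 < D ->
  forall a s x y, near a M (bucket a M D s) B D x y ->
  exists t, `|a * (x + y - s) - t * M| < 2 * D.
Proof.
move=> MBD B0 D0 a s x y.
set u := bucket a M D s - bucket a M D x.
move=> /orP[] /eqP h; [have e0 := divz_eq u B | have e0 := divz_eq (u - 1) B].
  apply: (near_collision M B D MBD B0 D0 a x y s 0 (- (u %/ B)%Z)); first by left.
  by rewrite h -/u; move: (u %% B)%Z (u %/ B)%Z e0 => r k ->; lia.
apply: (near_collision M B D MBD B0 D0 a x y s 1 (- ((u - 1) %/ B)%Z)); first by right.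
rewrite h -/u; move: ((u - 1) %% B)%Z ((u - 1) %/ B)%Z e0 => r k e0.
by have -> : u = 1 + (k * B + r); lia.
Qed.

(** Reduces to natural numbers with [d] the absolute value of [x + y - s]; a negative difference
    only changes the sign of [t]. *)
Lemma collision_count (M B D : nat) (s x y : int) :
  (M = D * B)%N -> (0 < B)%N -> (0 < D)%N -> x + y != s ->
  `|x + y - s| <= D%:Z ->
  (#|[set a : 'I_M | near a%:Z M%:Z (bucket a%:Z M%:Z D%:Z s) B%:Z D%:Z x y]|
     <= 20 * D)%N.
Proof.
move=> MBD B0 D0 ne hd.
have MBDz : M%:Z = D%:Z * B%:Z by rewrite MBD PoszM.
apply: (collision_count_nat (absz (x + y - s)%R) D M) => [||a].
- by lia.
- by rewrite MBD leq_pmulr.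
case/(near_window _ _ _ MBDz B0 D0) => t ht.
have e : (a * absz (x + y - s)%R)%N%:Z = a%:Z * `|x + y - s|.
  by rewrite PoszM.
case: (lerP 0 (x + y - s)) => h0.
  by exists t; rewrite e (ger0_norm h0).
by exists (- t); rewrite e (ltr0_norm h0) mulrN mulNr -opprD normrN.
Qed.

(** * Candidate pairs and the cost of enumerating them *)

Section Candidates.
Variables (inp : seq int) (n : nat) (a M rr B D sg oX oY : int).
Local Notation X := (Xv inp sg oX).
Local Notation Y := (Yv inp sg oY).
Local Notation nearXY i j := (near a M rr B D (X i) (Y j)).
Local Notation candidates := (vals inp n a M rr B D sg oX oY 0).

Lemma mem_vis x v :
  (v \in vis inp n a M rr B D sg oY x) =
  [exists j : 'I_n, near a M rr B D x (Y j) && (v == x + Y j)].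
Proof.
rewrite mem_cat; apply/idP/existsP.
  move=> /orP[] /mapP[j]; rewrite mem_filter mem_iota => /andP[hk /andP[_ hj]] ->;
    by exists (Ordinal hj); rewrite /near hk ?orbT eqxx.
move=> [j /andP[/orP[] hk /eqP ->]]; apply/orP; [left|right];
  by apply/mapP; exists (val j) => //; rewrite mem_filter hk mem_iota /=.
Qed.

Lemma vals_sound v : v \in candidates ->
  exists i j, [/\ (i < n)%N, (j < n)%N & v = X i + Y j].
Proof.
move=> /flattenP[vs /mapP[i]]; rewrite mem_iota => /andP[_ hi] ->.
by rewrite mem_vis => /existsP[j /andP[_ /eqP ->]]; exists i, j; split => //; lia.
Qed.

Lemma vals_complete i j : (i < n)%N -> (j < n)%N -> nearXY i j -> X i + Y j \in candidates.
Proof.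
move=> hi hj h; apply: (vis_vals _ _ _ _ _ _ _ _ _ _ i); first by lia.
by rewrite mem_vis; apply/existsP; exists (Ordinal hj); rewrite h eqxx.
Qed.

Definition false_near (s : int) : {set 'I_n * 'I_n} :=
  [set p : 'I_n * 'I_n | (X p.1 + Y p.2 != s) && nearXY p.1 p.2].

(* Each value of the first array is expanded only once, so a second element
   completes it to the sum [s] at most [n] times in total. *)
Lemma cost_bound s :
  (cost inp n a M rr B D sg oX oY n <= 2 * (n + #|false_near s|))%N.
Proof.
have card_iota (p : pred nat) : size [seq j <- iota 0 n | p j] = (\sum_(j < n) p j)%N.
  by rewrite size_filter -sum1_count big_mkcond /= -{1}[n]subn0 -/(index_iota 0 n)
    big_mkord; apply: eq_bigr => j _; case: (p j).
(* The last index carrying its value; only these indices are charged by [cost]. *)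
pose rep (i : 'I_n) := X i \notin xs inp n sg oX i.+1.
(* The factor 2 covers the case where both visits walk the same bucket, as for [B = 1]. *)
have visE i : (size (vis inp n a M rr B D sg oY (X i)) <= 2 * \sum_(j < n) nearXY i j)%N.
  rewrite size_cat !size_map !card_iota -big_split /= big_distrr /=.
  apply: leq_sum => j _; rewrite /near.
  by case: (_ == _); case: (_ == _).
pose hit i j := rep i && (X i + Y j == s).
have : (cost inp n a M rr B D sg oX oY n <=
    \sum_(i < n) 2 * \sum_(j < n) (hit i j + ((i, j) \in false_near s)))%N.
  apply: leq_sum => i _; case: ifP => // hin; apply: leq_trans (visE i) _.
  rewrite leq_mul2l /=; apply: leq_sum => j _; rewrite /hit /rep hin inE /=.
  by case: (_ == s); case: (near _ _ _ _ _ _ _).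
move=> h; apply: leq_trans h _; rewrite -big_distrr /= leq_mul2l /= pair_big /= big_split /= leq_add //; last first.
  by rewrite -sum1_card [leqRHS]big_mkcond /=; apply: leq_sum => -[i j] _ /=; case: ifP.
(* For fixed [j] a hit forces [X i = s - Y j], and only one representative carries this value. *)
rewrite -(pair_big xpredT xpredT
  (fun i j : 'I_n => hit i j : nat)) /= exchange_big /=.
rewrite -[leqRHS]card_ord -sum1_card; apply: leq_sum => j _.
have -> : (\sum_(i < n) hit i j = #|[set i | hit i j]|)%N.
  by rewrite -sum1_card [RHS]big_mkcond /=; apply: eq_bigr => i _; rewrite inE; case: ifP.
have lt_rep (i i' : 'I_n) : (i < i')%N -> X i = X i' -> ~~ rep i.
  move=> lt e; rewrite negbK e; apply/mapP; exists (nat_of_ord i') => //.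
  by rewrite mem_iota; have := ltn_ord i'; lia.
apply/card_le1_eqP => i i'; rewrite !inE => /andP[ri /eqP ei] /andP[ri' /eqP ei'].
have e : X i = X i' by apply: (addIr (Y j)); rewrite ei ei'.
apply: val_inj; case: (ltngtP i i') => // lt.
  by move: ri; rewrite (negbTE (lt_rep _ _ lt e)).
by move: ri'; rewrite (negbTE (lt_rep _ _ lt (esym e))).
Qed.

End Candidates.

(** Double counting: exchange the sums over multipliers and over pairs, then apply [collision_count]
    to each pair whose sum is not [s]. *)
Lemma sum_false_near (inp : seq int) (n M B D : nat) (sg oX oY s : int) :
  (M = D * B)%N -> (0 < B)%N -> (0 < D)%N ->
  (forall i j, `|Xv inp sg oX i + Yv inp sg oY j - s| <= D%:Z) ->
  (\sum_(a < M) #|false_near inp n a%:Z M%:Z (bucket a%:Z M%:Z D%:Z s)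
      B%:Z D%:Z sg oX oY s| <= n * n * (20 * D))%N.
Proof.
move=> MBD B0 D0 hd.
pose F (a : 'I_M) := false_near inp n a%:Z M%:Z (bucket a%:Z M%:Z D%:Z s)
      B%:Z D%:Z sg oX oY s.
have -> : (\sum_(a < M) #|F a| = \sum_(p : 'I_n * 'I_n) #|[set a | p \in F a]|)%N.
  transitivity (\sum_(a < M) \sum_(p : 'I_n * 'I_n) (p \in F a))%N.
    by apply: eq_bigr => a _; rewrite -sum1_card big_mkcond; apply: eq_bigr => p _; case: ifP.
  rewrite exchange_big; apply: eq_bigr => p _.
  rewrite -sum1_card [RHS]big_mkcond /=; apply: eq_bigr => a _.
  have -> : (a \in [set a0 | p \in F a0]) = (p \in F a) by rewrite in_set.
  by case: (p \in F a).
apply: (@leq_trans (\sum_(p : 'I_n * 'I_n) 20 * D)%N); last first.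
  by rewrite sum_nat_const card_prod !card_ord.
apply: leq_sum => -[i j] _.
case: (eqVneq (Xv inp sg oX i + Yv inp sg oY j) s) => [e|ne].
  rewrite (_ : [set _ | _] = set0) ?cards0 //.
  by apply/setP => a; rewrite !inE /= e eqxx.
apply: leq_trans (collision_count M B D s _ _ MBD B0 D0 ne (hd i j)).
by apply/subset_leq_card/subsetP => a; rewrite !inE /= => /andP[].
Qed.

(** * The protocol *)

Lemma run_more P W inp rnd prf f g c b :
  run P W inp rnd prf f c = Some b -> run P W inp rnd prf (f + g) c = Some b.
Proof.
elim: f c => [|f IH] c //=.
by case: (step _ _ _ _ _ c) => [c'|b'|] //; exact: IH.
Qed.

Lemma bval_inj s1 s2 : size s1 = size s2 -> bval s1 = bval s2 -> s1 = s2.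
Proof.
elim: s1 s2 => [|b1 s1 IH] [|b2 s2] //= [hs] e.
have [-> e'] : b1 = b2 /\ bval s1 = bval s2 by case: (b1) (b2) e => [] []; lia.
by rewrite (IH s2).
Qed.

Lemma bval_surj k r : (r < 2 ^ k)%N -> exists t : k.-tuple bool, bval t = r.
Proof.
elim: k r => [|k IH] r; first by move=> h; exists [tuple]; rewrite /=; lia.
rewrite expnS => h; have [|t ht] := IH r./2; first by lia.
exists [tuple of odd r :: t]; rewrite /= ht mul2n; exact: odd_double_half.
Qed.

Lemma markov_count (N b : nat) (f : 'I_N -> nat) :
  (b.+1 * #|[set a | (b < f a)%N]| <= \sum_a f a)%N.
Proof.
rewrite -sum1_card big_mkcond /= big_distrr /=; apply: leq_sum => a _.
by rewrite inE; case: ifP => h; lia.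
Qed.

(** Carries bounds on bad multipliers over to random strings, [bval] being injective on strings of
    equal length. *)
Lemma tuple_count (w : nat) (p : pred nat) :
  (#|[set r : w.-tuple bool | p (bval r)]| <= #|[set a : 'I_(2 ^ w) | p a]|)%N.
Proof.
have lt (r : w.-tuple bool) : (bval r < 2 ^ w)%N.
  by have := bval_lt r; rewrite size_tuple.
pose f r := Ordinal (lt r).
have inj : injective f.
  move=> r1 r2 [e]; apply: val_inj; apply: bval_inj => //.
  by rewrite !size_tuple.
rewrite -(card_imset _ inj); apply/subset_leq_card/subsetP => a.
by move=> /imsetP[r]; rewrite !inE => h ->.
Qed.

Section Protocol.
Variables (c n : nat) (A1 A2 A3 A4 : seq int).
Hypotheses (s1 : size A1 = n) (s2 : size A2 = n) (s3 : size A3 = n) (s4 : size A4 = n).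
Hypothesis bnd : forall x, x \in A1 ++ A2 ++ A3 ++ A4 -> `|x| <= (n ^ c)%:Z.

Let L := trunc_log 2 n.
(** Chosen so that the bucket width [2 ^ (w - L)] is at least [4 * n ^ c], which bounds every
    difference [x + y - s]. *)
Let w := ((c + 3) * L.+1)%N.
Let W := ((n + 2) ^ (3 * c + 13))%N.
Let inp := A1 ++ A2 ++ A3 ++ A4.

Lemma input_bound i : `|nth_at 0 inp i| <= (n ^ c)%N%:Z.
Proof.
rewrite /nth_at; case: ifP => [_|_]; last by rewrite normr0; lia.
case: (ltnP `|i|%N (size inp)) => h; first by apply: bnd; exact: mem_nth.
by rewrite nth_default // normr0; lia.
Qed.

Lemma trunc_log_le : (2 ^ L.+1 <= (n + 2) ^ 2)%N.
Proof.
rewrite /L; case: n => [|n']; first by rewrite trunc_log0.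
have := trunc_logP (isT : 1 < 2)%N (isT : 0 < n'.+1)%N.
by rewrite expnS; move: (2 ^ _)%N => z hz; nia.
Qed.

(** By [trunc_log_le] the modulus [2 ^ w] costs [2 * (c + 3)] factors [n + 2], and 100, being below
    [2 ^ 7], costs seven more; the exponent [3 * c + 13] also leaves [c] factors for the entries. *)
Lemma word_bounds : [/\ (100 * n ^ c <= W)%N, (100 * n <= W)%N,
  (100 * 2 ^ w <= W)%N & (2 ^ w * n ^ c <= W)%N].
Proof.
have N0 : (0 < n + 2)%N by lia.
have mono i j : (i <= j -> (n + 2) ^ i <= (n + 2) ^ j)%N by move=> h; rewrite leq_pexp2l.
have h100 : (100 <= (n + 2) ^ 7)%N.
  by apply: (@leq_trans (2 ^ 7)) => //; rewrite leq_exp2r //; lia.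
have hX : (n ^ c <= (n + 2) ^ c)%N.
  by case: (c) => // c'; rewrite leq_exp2r //; lia.
have hw : (2 ^ w <= (n + 2) ^ (2 * (c + 3)))%N.
  rewrite /w mulnC expnM [X in (_ <= X)%N]expnM leq_exp2r ?addn3 //.
  exact: trunc_log_le.
have W7 z i : (z <= (n + 2) ^ i -> i + 7 <= 3 * c + 13 -> 100 * z <= W)%N.
  move=> hz hi; apply: (@leq_trans ((n + 2) ^ (i + 7))); last exact: mono.
  by rewrite expnD mulnC leq_mul.
split.
- by apply: (W7 _ _ hX); lia.
- by apply: (W7 _ 1%N); rewrite ?expn1; lia.
- by apply: (W7 _ _ hw); lia.
- apply: (@leq_trans ((n + 2) ^ (2 * (c + 3) + c))); last by apply: mono; lia.
  by rewrite expnD leq_mul.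
Qed.

Lemma input1 i : (i < n)%N -> Xv inp (sgq false) (offX n false) i = nth 0 A1 i.
Proof.
move=> hi; rewrite /Xv /sgq /offX mul1r addr0 /nth_at /=.
by rewrite nth_cat s1 hi.
Qed.

Lemma input2 i : (i < n)%N -> Yv inp (sgq false) (offY n false) i = nth 0 A2 i.
Proof.
move=> hi; rewrite /Yv /sgq /offY mul1r -PoszD /nth_at /= nth_cat s1.
rewrite ifF; last by lia.
by rewrite nth_cat s2 ifT; [congr nth; lia | lia].
Qed.

Lemma input3 i : (i < n)%N -> Xv inp (sgq true) (offX n true) i = - nth 0 A3 i.
Proof.
move=> hi; rewrite /Xv /sgq /offX mulN1r -PoszM -PoszD /nth_at /= nth_cat s1.
rewrite ifF; last by lia.
rewrite nth_cat s2 ifF; last by lia.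
by rewrite nth_cat s3 ifT; [congr (- nth _ _ _); lia | lia].
Qed.

Lemma input4 i : (i < n)%N -> Yv inp (sgq true) (offY n true) i = - nth 0 A4 i.
Proof.
move=> hi; rewrite /Yv /sgq /offY mulN1r -PoszM -PoszD /nth_at /= nth_cat s1.
rewrite ifF; last by lia.
rewrite nth_cat s2 ifF; last by lia.
rewrite nth_cat s3 ifF; last by lia.
by congr (- nth _ _ _); lia.
Qed.

Lemma protocol_halts (r pi : seq bool) : size r = w -> (size pi <= L)%N ->
  exists t b,
  [/\ forall f, run (compile 0 verifier) W inp r pi (t + f)
        (init_config n (size r) (size pi)) = Some b,
      (t <= time_bound n inp r pi)%N
    & b <-> exists2 v, v \in sums n inp r pi false & v \in sums n inp r pi true].
Proof.
move=> hr hpi; have [b1 b2 b3 b4] := word_bounds.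
apply: (verifier_halts W n (n ^ c)); rewrite ?hr //.
- exact: input_bound.
- by apply: leq_trans hpi _; rewrite /w; nia.
Qed.

(** An accepting run must agree with the verdict of [protocol_halts], and a common value of the two
    lists yields the four indices, whatever bucket Merlin claims. *)
Lemma protocol_sound (r pi : seq bool) T : size r = w -> (size pi <= L)%N ->
  accepts (compile 0 verifier) W T n inp r pi -> four_sum n A1 A2 A3 A4.
Proof.
move=> hr hpi /eqP acc; have [t [b [hrun _ hb]]] := protocol_halts r pi hr hpi.
have := run_more _ _ _ _ _ _ t _ _ acc; rewrite addnC hrun => -[b1].
have [v] := hb.1 b1.
move=> /vals_sound[i1 [i2 [h1 h2 ->]]] /vals_sound[i3 [i4 [h3 h4]]].
rewrite input1 // input2 // input3 // input4 // => e.
by exists i1, i2, i3, i4; split; [split | lia].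
Qed.

(** Merlin fixes one solution and sends the bucket of its partial sum [s]; the only strings that may
    be lost are those whose multiplier creates too many false candidates. *)
Lemma protocol_complete : four_sum n A1 A2 A3 A4 ->
  (2 * 2 ^ w <= 3 * #|[set r : w.-tuple bool | [exists pi : L.-tuple bool,
     accepts (compile 0 verifier) W
       ((20 * (c + 3) + 150 * 100) * n.+1 * L.+1 ^ 1) n inp r pi]]|)%N.
Proof.
move=> [i1 [i2 [i3 [i4 [[h1 h2 h3 h4] hsum]]]]].
have n0 : (0 < n)%N by lia.
pose M := (2 ^ w)%N; pose B := (2 ^ L)%N; pose D := (2 ^ (w - L))%N.
have Lw : (L <= w)%N by rewrite /w; nia.
have MBD : (M = D * B)%N by rewrite /M /B /D -expnD subnK.
have B0 : (0 < B)%N by rewrite expn_gt0.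
have D0 : (0 < D)%N by rewrite expn_gt0.
have nB : (n < 2 * B)%N by rewrite /B -expnS; exact: trunc_log_ltn.
have XD : (4 * n ^ c <= D)%N.
  have hn : (n ^ c <= (2 ^ L.+1) ^ c)%N.
    by case: (c) => // c'; rewrite leq_exp2r // ltnW // trunc_log_ltn.
  apply: (@leq_trans (2 ^ (L.+1 * c + 2))).
    by rewrite expnD expnM mulnC leq_mul2r hn orbT.
  by rewrite /D leq_exp2l // /w; nia.
have MBDz : M%:Z = D%:Z * B%:Z by rewrite MBD PoszM.
pose s := nth 0 A1 i1 + nth 0 A2 i2.
have hs : s = - nth 0 A3 i3 - nth 0 A4 i4 by rewrite /s; lia.
have hsg q : `|sgq q| = 1 by case: q.
have hXv q i : `|Xv inp (sgq q) (offX n q) i| <= (n ^ c)%N%:Z.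
  by rewrite /Xv normrM hsg mul1r input_bound.
have hYv q i : `|Yv inp (sgq q) (offY n q) i| <= (n ^ c)%N%:Z.
  by rewrite /Yv normrM hsg mul1r input_bound.
have sX : s = Xv inp (sgq false) (offX n false) i1 + Yv inp (sgq false) (offY n false) i2.
  by rewrite input1 // input2.
have sY : s = Xv inp (sgq true) (offX n true) i3 + Yv inp (sgq true) (offY n true) i4.
  by rewrite input3 // input4.
have hd q i j : `|Xv inp (sgq q) (offX n q) i + Yv inp (sgq q) (offY n q) j - s| <= D%:Z.
  have := hXv q i; have := hYv q j; have := hXv false i1; have := hYv false i2.
  by rewrite sX; move: (Xv _ _ _ _) (Yv _ _ _ _) (Xv _ _ _ _) (Yv _ _ _ _); lia.
pose rr (a : nat) := bucket a%:Z M%:Z D%:Z s.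
pose F q (a : nat) := #|false_near inp n a%:Z M%:Z (rr a) B%:Z D%:Z
  (sgq q) (offX n q) (offY n q) s|.
(* On average both phases together have at most [40 * n ^ 2 * D / M = 40 * n ^ 2 / B] false pairs,
   which is below [80 * n] as [n < 2 * B]; the threshold is three times that. *)
pose few a := (F false a + F true a <= 240 * n)%N.
have hF q : (\sum_(a < M) F q a <= n * n * (20 * D))%N.
  exact: (sum_false_near _ _ _ _ _ _ _ _ _ MBD B0 D0 (hd q)).
have hbad : (3 * #|[set a : 'I_M | ~~ few a]| <= M)%N.
  have := markov_count M (240 * n) (fun a => F false a + F true a)%N.
  rewrite big_split /= => hm.
  have -> : [set a : 'I_M | ~~ few a] = [set a : 'I_M | (240 * n < F false a + F true a)%N].
    by apply/setP => a; rewrite !inE /few -ltnNge.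
  move: #|_| hm => K hm.
  have h40 : (240 * n * K <= 40 * (n * n) * D)%N.
    apply: (@leq_trans ((240 * n).+1 * K)); first by rewrite leq_mul2r leqnSn orbT.
    by apply: leq_trans hm _; apply: leq_trans (leq_add (hF false) (hF true)) _; lia.
  have h80 : (40 * (n * n) * D <= 80 * n * M)%N.
    rewrite MBD; have : (n * (n * D) <= 2 * B * (n * D))%N by rewrite leq_mul2r ltnW ?orbT.
    lia.
  have : (240 * n * K <= 80 * n * M)%N by apply: leq_trans h40 h80.
  have -> : (240 * n * K = 80 * n * (3 * K))%N by lia.
  by rewrite leq_pmul2l //; lia.
have bad_tuples : (3 * #|[set r : w.-tuple bool | ~~ few (bval r)]| <= M)%N.
  apply: leq_trans hbad; rewrite leq_mul2l /=.
  exact: (tuple_count w (fun a => ~~ few a)).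
set good := [set r : w.-tuple bool | [exists pi, _]].
(* Few false pairs suffice for acceptance: the bucket of [s] is below [B = 2 ^ L], so it fits into
   [L] bits. *)
have cov : ~: good \subset [set r : w.-tuple bool | ~~ few (bval r)].
  rewrite -setCS setCK; apply/subsetP => r; rewrite !inE negbK => hfew.
  have hrr : 0 <= rr (bval r) < B%:Z.
    by apply: bucket_range => //; lia.
  have [|pi hpi] := bval_surj L (absz (rr (bval r))); first by rewrite -/B; lia.
  apply/existsP; exists pi.
  have hpiz : (bval pi)%:Z = rr (bval r) by rewrite hpi; lia.
  have hszr : size r = w by rewrite size_tuple.
  have hszp : size pi = L by rewrite size_tuple.
  have [|t [b [hrun ht hb]]] := protocol_halts r pi hszr; first by rewrite hszp.
  have DE : (M%:Z %/ B%:Z)%Z = D%:Z by rewrite MBDz mulzK //; lia.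
  have sumsE q : sums n inp r pi q = vals inp n (bval r)%:Z M%:Z (rr (bval r)) B%:Z D%:Z
      (sgq q) (offX n q) (offY n q) 0.
    by rewrite /sums hszr hszp hpiz -/M -/B DE.
  have visE q : (visits n inp r pi q <= 2 * (n + F q (bval r)))%N.
    by rewrite /visits hszr hszp hpiz -/M -/B DE; exact: cost_bound.
  have hnear x y : x + y = s -> near (bval r)%:Z M%:Z (rr (bval r)) B%:Z D%:Z x y.
    by move=> e; rewrite /rr -e; apply: near_exact => //; lia.
  have hbt : b.
    apply/hb; exists s; rewrite sumsE.
      by rewrite sX; apply: vals_complete => //; apply: hnear.
    by rewrite sY; apply: vals_complete => //; apply: hnear.
  rewrite /accepts.
  (* The visits total at most [484 * n], and [30 * 484 + 160 = 14680] is below [150 * 100]; the term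
     [20 * (c + 3)] pays for reading the bits. *)
  suff hT : (t <= (20 * (c + 3) + 150 * 100) * n.+1 * L.+1 ^ 1)%N.
    by rewrite -(subnKC hT) hrun hbt.
  apply: leq_trans ht _; rewrite /time_bound hszr hszp expn1.
  have v0 := visE false; have v1 := visE true.
  have w1 : (w <= (c + 3) * n.+1 * L.+1)%N by rewrite /w; nia.
  have w2 : (n.+1 <= n.+1 * L.+1)%N by rewrite leq_pmulr.
  move: hfew v0 v1; rewrite /few.
  move: (F false _) (F true _) (visits _ _ _ _ false) (visits _ _ _ _ true) => f0 f1 u0 u1.
  move: w1 w2; rewrite -!mulnA [((20 * _ + _) * _)%N]mulnDl; move: (n.+1 * L.+1)%N => z w1 w2.
  by rewrite -[(20 * _ * _)%N]mulnA; move: ((c + 3) * z)%N w1 => y; lia.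
have := leq_mul (leqnn 3) (subset_leq_card cov).
have := cardsC good; rewrite card_tuple card_bool -/M; lia.
Qed.

End Protocol.

(* For every constant c (entries bounded by n^c in absolute value) there is a
   uniform verifier: a word-RAM program P, a number m n of shared random bits,
   a word bound (n+2)^k (O(log n)-bit words) and a time bound
   C (n+1) (log n + 1)^e = O~(n), such that proofs have at most log_2 n bits,
   completeness holds with probability >= 2/3 and soundness is perfect. *)
Theorem mainTheorem1 (c : nat) :
  exists (P : seq instr) (m : nat -> nat) (k C e : nat),
  forall (n : nat) (A1 A2 A3 A4 : seq int),
    size A1 = n -> size A2 = n -> size A3 = n -> size A4 = n ->
    (forall x, x \in A1 ++ A2 ++ A3 ++ A4 -> `|x| <= (n ^ c)%:Z) ->
    let W := ((n + 2) ^ k)%N in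
    let T := (C * n.+1 * (trunc_log 2 n).+1 ^ e)%N in
    let inp := A1 ++ A2 ++ A3 ++ A4 in
    (four_sum n A1 A2 A3 A4 ->
       (2 * 2 ^ m n <=
        3 * #|[set r : (m n).-tuple bool |
                [exists l : 'I_(trunc_log 2 n).+1,
                   [exists pi : l.-tuple bool, accepts P W T n inp r pi]]]|)%N)
    /\
    (~ four_sum n A1 A2 A3 A4 ->
       forall (r : (m n).-tuple bool) (pi : seq bool),
         (size pi <= trunc_log 2 n)%N -> ~~ accepts P W T n inp r pi).
Proof.
exists (compile 0 verifier), (fun n => (c + 3) * (trunc_log 2 n).+1)%N,
  (3 * c + 13)%N, (20 * (c + 3) + 150 * 100)%N, 1%N.
move=> n A1 A2 A3 A4 s1 s2 s3 s4 bnd W T inp; split=> [yes|no r pi hpi].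
  apply: leq_trans (protocol_complete c n A1 A2 A3 A4 s1 s2 s3 s4 bnd yes) _.
  rewrite leq_mul2l /=; apply/subset_leq_card/subsetP => r; rewrite !inE => acc.
  (* The honest proof uses the full permitted length. *)
  by apply/existsP; exists ord_max.
apply/negP => acc; apply: no; apply: protocol_sound acc => //.
by rewrite size_tuple.
Qed.
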